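(* Let $k\ge 1$ and let $\Gamma$ be a general Martens-special chain of cycles of type $k$ and genus $g$. Then its gonality sequence $(g_r(\Gamma))_{r\ge 1}$ is given by \begin{itemize} \item $g_r(\Gamma)=k+2r$ for $1\le r\le g-k-1$, \item $g_r(\Gamma)=r+g-1$ for $g-k\le r\le g-1$, \item $g_r(\Gamma)=r+g$ for $r\ge g$. \end{itemize}
   Context: Divisors on metric graphs. A metric graph is a compact connected metric space obtained from a finite graph by giving every edge a positive length. A divisor $D$ on a metric graph $\Gamma$ is a finite formal $\mathbb{Z}$-combination of points of $\Gamma$; its degree is the sum of its coefficients; it is effective if all coefficients are $\ge 0$. A rational function on $\Gamma$ is a continuous, piecewise affine function $f:\Gamma\to\mathbb{R}$ with integer slopes and finitely many pieces; $\mathrm{div}(f)$ is the divisor whose coefficient at a point $p$ is the sum of the outgoing slopes of $f$ at $p$ (the sign convention is irrelevant). Divisors $D_1,D_2$ are (linearly) equivalent if $D_1-D_2=\mathrm{div}(f)$ for some rational function $f$. The rank $\mathrm{rk}(D)$ is $-1$ if $D$ is not equivalent to an effective divisor; otherwise it is the largest integer $r\ge 0$ such that for each effective divisor $E$ of degree $r$ there is an effective divisor $D'$ equivalent to $D$ with $D'-E$ effective. Gonality sequence. For an integer $r\ge 1$, $g_r(\Gamma)$ is the minimal integer $n$ such that there is a divisor $D$ on $\Gamma$ with $\deg(D)=n$ and $\mathrm{rk}(D)\ge r$. Chains of cycles. A chain of cycles $\Gamma$ of genus $g\ge 1$ is a metric graph consisting of $g$ cycles $C_1,\dots,C_g$ such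 that, for $1\le i\le g-1$, $C_i$ and $C_{i+1}$ are connected by a segment going from a point $w_i\in C_i$ to a point $v_{i+1}\in C_{i+1}$; moreover points $v_1\in C_1$ and $w_g\in C_g$ are chosen, and $v_i\ne w_i$ for $1\le i\le g$. Each cycle is given an orientation. Its torsion profile $\underline m=(m_2,\dots,m_g)$ is defined as follows: let $l_i$ be the length of $C_i$ and $l(v_i,w_i)$ the length of the positively oriented arc on $C_i$ from $v_i$ to $w_i$; if $l_i$ is an irrational multiple of $l(v_i,w_i)$ then $m_i=0$, otherwise $m_i$ is the minimal positive integer such that $m_i\cdot l(v_i,w_i)$ is an integer multiple of $l_i$. Martens-special chains. A chain of cycles of genus $g$ is a Martens-special chain of cycles of type $k$ ($k\ge 1$) if there are integers $3\le j_1\le j_2\le\dots\le j_k\le g-2$ with $j_{i+1}-j_i\ge 2$ for $1\le i\le k-1$ such that $m_i\ne 2$ for $i\in\{j_1,\dots,j_k\}$ and $m_i=2$ for $i\in\{2,\dots,g\}\setminus\{j_1,\dots,j_k\}$. It is called general if $m_i=0$ whenever $m_i\ne 2$. *)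

(* Defs.v *)
From HB Require Import structures.
From mathcomp Require Import all_boot all_order all_algebra.
From mathcomp Require Import boolp classical_sets reals.
From mathcomp Require Import freeg.

Set Implicit Arguments.
Unset Strict Implicit.
Unset Printing Implicit Defensive.

Import Order.TTheory GRing.Theory Num.Theory.
Local Open Scope ring_scope.

(* Loops and multiple edges are allowed. *)
Record metric_graph (R : realType) := MetricGraph {
  vertex : finType;
  edge : finType;
  src : edge -> vertex;
  tgt : edge -> vertex;
  len : edge -> R;
  len_gt0 : forall e, 0 < len e;
  vertex_gt0 : (0 < #|vertex|)%N;
  graph_connected : forall u v : vertex,
    connect (fun x y => [exists e, ((src e == x) && (tgt e == y))
                                || ((src e == y) && (tgt e == x))]) u v
}.

Section Divisors.
Variables (R : realType) (G : metric_graph R).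

(* The points of the metric graph: its vertices, and for each edge e the points
   at distance t from src e along e, for 0 < t < len e. *)
Definition graph_point : choiceType :=
  (vertex G + {x : edge G * R | 0 < x.2 < len x.1})%type.

(* The parametrization by arc length of the closed edge e; it is only
   meaningful for 0 <= t <= len e. *)
Definition edge_point (e : edge G) (t : R) : graph_point :=
  if insub (e, t) is Some x then inr x
  else if t <= 0 then inl (src e) else inl (tgt e).

(* Consecutive pieces are closed intervals sharing an end point, so such an h
   is continuous on [0, l]. *)
Definition piecewise_affine (l : R) (h : R -> R) : Prop :=
  exists s : seq R,
    [/\ path <%R 0 s, last 0 s = l &
        forall i, (i < size s)%N -> exists m : int, forall t,
          nth 0 (0 :: s) i <= t <= nth 0 s i ->
          h t = h (nth 0 (0 :: s) i) + m%:~R * (t - nth 0 (0 :: s) i)].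

(* Continuity on the whole graph follows: all the edges at a vertex v read the
   same value f (inl v). *)
Definition rational_function (f : graph_point -> R) : Prop :=
  forall e, piecewise_affine (len e) (f \o edge_point e).

(* d = 1 is the direction from src e to tgt e, and d = -1 the opposite one. *)
Definition is_outgoing_slope (f : graph_point -> R) (e : edge G) (t d : R) (m : int)
    : Prop :=
  exists2 eps : R, 0 < eps & forall u, 0 <= u < eps ->
    f (edge_point e (t + d * u)) = f (edge_point e t) + m%:~R * u.

(* For a rational function the slope exists and is unique, so the default
   value is irrelevant. *)
Definition outgoing_slope (f : graph_point -> R) (e : edge G) (t d : R) : int :=
  xget 0 [set m | is_outgoing_slope f e t d m].

(* A loop at v contributes both of its ends. *)
Definition sum_outgoing_slopes (f : graph_point -> R) (p : graph_point) : int :=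
  match p with
  | inl v => \sum_(e | src e == v) outgoing_slope f e 0 1
           + \sum_(e | tgt e == v) outgoing_slope f e (len e) (-1)
  | inr x => outgoing_slope f (val x).1 (val x).2 1
           + outgoing_slope f (val x).1 (val x).2 (-1)
  end.

Definition divisor := {freeg graph_point}.

Definition is_div (f : graph_point -> R) (D : divisor) : Prop :=
  forall p, coeff p D = sum_outgoing_slopes f p.

Definition effective (D : divisor) : Prop := forall p, 0 <= coeff p D.

Definition lin_equiv (D1 D2 : divisor) : Prop :=
  exists2 f, rational_function f & is_div f (D1 - D2).

Definition rank_atleast (D : divisor) (r : nat) : Prop :=
  forall E : divisor, effective E -> deg E = r%:Z ->
    exists D' : divisor, [/\ effective D', lin_equiv D' D & effective (D' - E)].

(* When D is equivalent to an effective divisor the largest r exists, since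
   rank_atleast D r implies r <= deg D. *)
Definition rank (D : divisor) : int :=
  if `[< exists2 D' : divisor, effective D' & lin_equiv D D' >] then
    (xget 0%N [set r : nat | rank_atleast D r /\
                 forall s, rank_atleast D s -> (s <= r)%N])%:Z
  else -1.

(* g_r(G) = n; the minimum is asserted to exist. *)
Definition is_gonality (r : nat) (n : int) : Prop :=
  (exists D : divisor, deg D = n /\ r%:Z <= rank D) /\
  (forall D : divisor, r%:Z <= rank D -> n <= deg D).

End Divisors.

(* Indices are shifted: the ordinal i : 'I_g stands for the cycle C_(i+1).
   arc_len i is the length of the positively oriented arc of that cycle from
   v to w; the strict bounds say that v and w are distinct. bridge_len i is the
   length of the segment from w on cycle i to v on cycle i+1. *)
Record chain_of_cycles (R : realType) (g : nat) := ChainOfCycles {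
  genus_gt0 : (0 < g)%N;
  cycle_len : 'I_g -> R;
  arc_len : 'I_g -> R;
  bridge_len : 'I_g.-1 -> R;
  arc_len_gt0 : forall i, 0 < arc_len i;
  arc_len_lt : forall i, arc_len i < cycle_len i;
  bridge_len_gt0 : forall i, 0 < bridge_len i
}.

Section ChainGraph.
Variables (R : realType) (g : nat) (Gamma : chain_of_cycles R g).

(* (i, false) is the point v and (i, true) the point w of the cycle i. *)
Definition chain_vertex : finType := ('I_g * bool)%type.

(* inl (i, false) is the positively oriented arc of the cycle i from v to w,
   inl (i, true) is the other arc, also directed from v to w, and inr i is the
   bridge from the cycle i to the cycle i+1. *)
Definition chain_edge : finType := (('I_g * bool) + 'I_g.-1)%type.

Fact bridge_src_subproof (i : 'I_g.-1) : (i < g)%N.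
Proof. exact: leq_trans (ltn_ord i) (leq_pred g). Qed.

Fact bridge_tgt_subproof (i : 'I_g.-1) : (i.+1 < g)%N.
Proof. by rewrite -ltn_predRL. Qed.

Definition chain_src (e : chain_edge) : chain_vertex :=
  match e with
  | inl (i, _) => (i, false)
  | inr i => (Ordinal (bridge_src_subproof i), true)
  end.

Definition chain_tgt (e : chain_edge) : chain_vertex :=
  match e with
  | inl (i, _) => (i, true)
  | inr i => (Ordinal (bridge_tgt_subproof i), false)
  end.

Definition chain_len (e : chain_edge) : R :=
  match e with
  | inl (i, false) => arc_len Gamma i
  | inl (i, true) => cycle_len Gamma i - arc_len Gamma i
  | inr i => bridge_len Gamma i
  end.

Fact chain_len_gt0 e : 0 < chain_len e.
Proof.
case: e => [[i []]|i] /=; first by rewrite subr_gt0 arc_len_lt.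
- exact: arc_len_gt0.
- exact: bridge_len_gt0.
Qed.

Fact chain_vertex_gt0 : (0 < #|chain_vertex|)%N.
Proof. by rewrite card_prod card_ord card_bool muln_gt0 (genus_gt0 Gamma). Qed.

Fact chain_connected (u v : chain_vertex) :
  connect (fun x y => [exists e, ((chain_src e == x) && (chain_tgt e == y))
                       || ((chain_src e == y) && (chain_tgt e == x))]) u v.
Proof.
set adj := (X in connect X).
have adj_sym : connect_sym adj.
  apply: sym_connect_sym => x y; apply/existsP/existsP => -[e he];
  by exists e; rewrite orbC.
pose o : chain_vertex := (Ordinal (genus_gt0 Gamma), false).
have edgeP e : connect adj (chain_src e) (chain_tgt e).
  by apply/connect1/existsP; exists e; rewrite !eqxx.
have vP n (hn : (n < g)%N) : connect adj o (Ordinal hn, false).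
  elim: n hn => [|n IHn] hn.
    by rewrite (_ : (_, _) = o) //; congr pair; exact: val_inj.
  have hb : (n < g.-1)%N by rewrite ltn_predRL.
  apply: connect_trans (IHn (ltnW hn)) _.
  apply: connect_trans (edgeP (inl (Ordinal (ltnW hn), false))) _.
  rewrite /= (_ : (Ordinal (ltnW hn), true) = chain_src (inr (Ordinal hb)));
    last by congr pair; exact: val_inj.
  rewrite (_ : (Ordinal hn, false) = chain_tgt (inr (Ordinal hb))) //.
  by congr pair; exact: val_inj.
have oP x : connect adj o x.
  case: x => [[n hn] []]; last exact: vP.
  exact: connect_trans (vP n hn) (edgeP (inl (Ordinal hn, false))).
by apply: connect_trans (oP v); rewrite adj_sym.
Qed.

Definition chain_graph : metric_graph R :=
  MetricGraph chain_len_gt0 chain_vertex_gt0 chain_connected.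

(* torsion i is the entry m_(i+1) of the torsion profile; the entry m_1 is not
   part of the profile and is never used. When cycle_len i is a rational
   multiple of arc_len i a minimal m exists, both lengths being positive. *)
Definition torsion (i : 'I_g) : nat :=
  let l := cycle_len Gamma i in
  let a := arc_len Gamma i in
  let P (m : nat) := (0 < m)%N /\ exists z : int, m%:R * a = z%:~R * l in
  if `[< exists q : rat, l = ratr q * a >] then
    xget 0%N [set m | P m /\ forall m', P m' -> (m <= m')%N]
  else 0%N.

(* The entries of j and the numbers i.+1 are positions in 1, ..., g. *)
Definition martens_special (k : nat) : Prop :=
  exists j : k.-tuple nat,
    [/\ all (fun a => (3 <= a <= g - 2)%N) j,
        sorted (fun a b => (a + 2 <= b)%N) j,
        forall i : 'I_g, i.+1 \in j -> torsion i <> 2%N &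
        forall i : 'I_g, (2 <= i.+1)%N -> i.+1 \notin j -> torsion i = 2%N].

Definition general_chain : Prop :=
  forall i : 'I_g, (2 <= i.+1)%N -> torsion i <> 2%N -> torsion i = 0%N.

End ChainGraph.

(* Main.v *)
(** A chip at a point of the chain has, for each cycle n, a coordinate in the
circle R / l_n Z: the position of the retraction of the point to that cycle.
Pairing a principal divisor with a function which is affine on each edge shows
that degree and these coordinates are the complete invariants of linear
equivalence ([lin_equivP]).

For a divisor D let x_0 = deg D and x_(n+1) = x_n - 1, or x_(n+1) = x_n when the
coordinate of D on the cycle n is that of x_n chips at w_n.  Then x_n bounds the
number of chips on the cycles >= n in any effective divisor equivalent to D, and
D is equivalent to an effective divisor iff x_g >= 0.

For the lower bounds, an adversary subtracting vertices v_n and w_n forces a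
dynamical system on rows of boxes: at time n one may add a box to several rows,
provided the diagonals of the new boxes are congruent modulo the torsion m_n,
and row e can only grow while it is strictly shorter than row e - 1.  Two
disjoint chains of boxes from the first box to the last one of row r then have
to be filled; at a time with torsion 2 both can advance only if the number of
boxes filled so far on them is odd, and at a time with torsion 0 only one of
them can advance.  So an exceptional cycle only changes a parity and the next
cycle loses what was won. *)

Require Import Defs.
From mathcomp Require Import all_boot all_order all_algebra reals.
From mathcomp Require Import boolp classical_sets freeg ring lra zify.

Set Implicit Arguments.
Unset Strict Implicit.
Unset Printing Implicit Defensive.

Import Order.TTheory GRing.Theory Num.Theory.
Local Open Scope ring_scope.

(** * Pairing functions with divisors *)

Section Pairing.
Variables (K : choiceType) (T : comNzRingType).
Implicit Types (D : {freeg K}) (phi psi : K -> T).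

(** Linear extension of [phi] to divisors. Degrees, coefficients, chip counts and cycle coordinates
    all take this form, so identities between them reduce to identities between functions at each
    point. *)
Definition pairing phi D : T := \sum_(p <- dom D) (coeff p D)%:~R * phi p.

Lemma pairingE U phi D : uniq U -> (forall p, p \notin U -> coeff p D = 0) ->
  pairing phi D = \sum_(p <- U) (coeff p D)%:~R * phi p.
Proof.
move=> uU hU; rewrite /pairing [RHS](bigID (fun p => p \in dom D)) /=.
rewrite [X in _ + X]big1 ?addr0; last first.
  by move=> p /coeff_outdom ->; rewrite mul0r.
rewrite -[RHS]big_filter; apply: perm_big; apply: uniq_perm.
- exact: uniq_dom.
- exact: filter_uniq.
- move=> p; rewrite mem_filter mem_dom; case: eqP => //= hp.
  by apply/esym; apply: contraT => /hU.
Qed.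

Lemma pairingD phi D1 D2 : pairing phi (D1 + D2) = pairing phi D1 + pairing phi D2.
Proof.
pose U := undup (dom D1 ++ dom D2).
have hU D p : {subset dom D <= U} -> p \notin U -> coeff p D = 0.
  by move=> sD pU; apply/coeff_outdom/(contra _ pU)/sD.
have s1 : {subset dom D1 <= U} by move=> p; rewrite mem_undup mem_cat => ->.
have s2 : {subset dom D2 <= U} by move=> p; rewrite mem_undup mem_cat orbC => ->.
rewrite !(@pairingE U) ?undup_uniq //; try by move=> p ?; apply: hU.
  by rewrite -big_split; apply: eq_bigr => p _; rewrite coeffD rmorphD mulrDl.
by move=> p pU; rewrite coeffD !hU.
Qed.

Lemma pairing0 phi : pairing phi 0 = 0.
Proof. by rewrite /pairing dom0 big_nil. Qed.

Lemma pairingN phi D : pairing phi (- D) = - pairing phi D.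
Proof. by apply/(addrI (pairing phi D)); rewrite -pairingD !subrr pairing0. Qed.

Lemma pairingB phi D1 D2 : pairing phi (D1 - D2) = pairing phi D1 - pairing phi D2.
Proof. by rewrite pairingD pairingN. Qed.

Lemma pairing_sum phi (I : Type) (s : seq I) P (F : I -> {freeg K}) :
  pairing phi (\sum_(i <- s | P i) F i) = \sum_(i <- s | P i) pairing phi (F i).
Proof. by apply: big_morph; [exact: pairingD | exact: pairing0]. Qed.

Lemma pairingU phi c p : pairing phi << c *g p >> = c%:~R * phi p.
Proof.
rewrite (@pairingE [:: p]) //; first by rewrite big_seq1 coeffU eqxx mulr1.
by move=> q; rewrite inE => qp; rewrite coeffU eq_sym (negbTE qp) mulr0.
Qed.

Lemma pairing_split phi psi D :
  pairing (fun p => phi p + psi p) D = pairing phi D + pairing psi D.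
Proof. by rewrite -big_split; apply: eq_bigr => p _; rewrite mulrDr. Qed.

Lemma pairing_opp phi D : pairing (fun p => - phi p) D = - pairing phi D.
Proof. by rewrite -sumrN; apply: eq_bigr => p _; rewrite mulrN. Qed.

Lemma pairing_scale c phi D :
  pairing (fun p => c * phi p) D = c * pairing phi D.
Proof. by rewrite mulr_sumr; apply: eq_bigr => p _; rewrite mulrCA. Qed.

Lemma eq_pairing phi psi D : phi =1 psi -> pairing phi D = pairing psi D.
Proof. by move=> e; apply: eq_bigr => p _; rewrite e. Qed.

Lemma pairing_delta q D : pairing (fun p => (p == q)%:R) D = (coeff q D)%:~R.
Proof.
case: (boolP (q \in dom D)) => qD.
  rewrite /pairing (bigD1_seq q) ?uniq_dom //= eqxx mulr1 big1 ?addr0 //.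
  by move=> p /negbTE ->; rewrite mulr0.
rewrite (coeff_outdom qD) /pairing big_seq big1 // => p pD.
by case: eqP => [pq|]; rewrite ?mulr0 //; rewrite -pq pD in qD.
Qed.

End Pairing.

Lemma pairing_intr (K : choiceType) (T : comNzRingType) (phi : K -> int) (D : {freeg K}) :
  (pairing phi D)%:~R = pairing (fun p => (phi p)%:~R : T) D.
Proof. by rewrite rmorph_sum; apply: eq_bigr => p _; rewrite rmorphM /= intz. Qed.

Lemma pairing1 (K : choiceType) (D : {freeg K}) : pairing (fun=> 1 : int) D = deg D.
Proof.
rewrite /pairing -[in RHS](freeg_sumE D) raddf_sum /=.
by apply: eq_bigr => p _; rewrite intz mulr1 degU.
Qed.

(** * Slopes along an edge *)

Lemma bracket (R : realDomainType) (b : nat -> R) n t :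
  b 0%N <= t < b n.+1 -> exists2 i, (i <= n)%N & b i <= t < b i.+1.
Proof.
elim: n => [|n IHn] /andP[h0 h1]; first by exists 0%N; rewrite ?h0.
case: (leP (b n.+1) t) => hn; first by exists n.+1; rewrite ?hn.
by case: IHn => [|i hi bi]; [rewrite h0 | exists i; rewrite ?(leq_trans hi)].
Qed.

Section Slopes.
Variables (R : realType) (G : metric_graph R).
Implicit Types (f : graph_point G -> R) (e : edge G).

Lemma edge_point0 e : edge_point e 0 = inl (src e).
Proof. by rewrite /edge_point insubF ?lexx //= ltxx. Qed.

Lemma edge_point_len e : edge_point e (len e) = inl (tgt e).
Proof. by rewrite /edge_point insubF ?leNgt ?len_gt0 //= ltxx andbF. Qed.

Lemma edge_point_inr (x : {x : edge G * R | 0 < x.2 < len x.1}) :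
  edge_point (val x).1 (val x).2 = inr x.
Proof. by rewrite /edge_point -surjective_pairing valK. Qed.

Lemma edge_point_interior e t : 0 < t < len e ->
  exists2 x, edge_point e t = inr x & val x = (e, t).
Proof. by move=> h; exists (exist _ (e, t) h) => //; rewrite -edge_point_inr. Qed.

Lemma edge_point_inj e e' t t' : 0 < t < len e -> 0 < t' < len e' ->
  edge_point e t = edge_point e' t' -> (e, t) = (e', t').
Proof.
by move=> /edge_point_interior[x -> <-] /edge_point_interior[x' -> <-] [->].
Qed.

Lemma outgoing_slopeE f e t d m :
  is_outgoing_slope f e t d m -> outgoing_slope f e t d = m.
Proof.
move=> hm; apply: xget_unique => // m' [eps' eps'0 hm'].
case: hm => eps eps0 hm; pose u := Num.min eps eps' / 2.
have u0 : 0 < u by rewrite divr_gt0 // lt_min eps0.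
have uM : u < Num.min eps eps' by rewrite ltr_pdivrMr // ltr_pMr ?ltr1n // lt_min eps0.
move: uM; rewrite lt_min => /andP[u1 u2].
have := hm' u; rewrite hm ?(ltW u0) // => /(_ u2) /addrI /mulIf.
by rewrite gt_eqF // => /(_ isT) /intr_inj ->.
Qed.

Lemma sum_outgoing_slopes_interior f e t : 0 < t < len e ->
  sum_outgoing_slopes f (edge_point e t) =
  outgoing_slope f e t 1 + outgoing_slope f e t (-1).
Proof. by move=> /edge_point_interior[x -> /= ->]. Qed.

Lemma affine_slopes f e (a b : R) (m : int) :
  (forall t, a <= t <= b ->
     f (edge_point e t) = f (edge_point e a) + m%:~R * (t - a)) ->
  (forall t, a <= t < b -> outgoing_slope f e t 1 = m) /\
  (forall t, a < t <= b -> outgoing_slope f e t (-1) = - m).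
Proof.
move=> h; split=> t /andP[ta tb]; apply: outgoing_slopeE.
  exists (b - t); first by rewrite subr_gt0.
  move=> u /andP[u0 ub]; rewrite (h (t + 1 * u)) ?(h t) ?ta ?(ltW tb) //; first by ring.
  by apply/andP; split; lra.
exists (t - a); first by rewrite subr_gt0.
move=> u /andP[u0 ub]; rewrite (h (t + -1 * u)) ?(h t) ?tb ?(ltW ta) //; first by rewrite rmorphN /=; ring.
by apply/andP; split; lra.
Qed.

(** Summation by parts along [e], with [mu] and [nu] the first and last slopes and [U] the interior
    break points: the jumps of the slope telescope, and their first moment leaves the increment of
    [f]. *)
Lemma rational_edge_slopes f e : rational_function f ->
  exists mu nu : int, exists U : seq R,
  [/\ uniq U /\ (forall t, t \in U -> 0 < t < len e),
      forall t, 0 < t < len e -> t \notin U ->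
        sum_outgoing_slopes f (edge_point e t) = 0,
      outgoing_slope f e 0 1 = mu /\ outgoing_slope f e (len e) (-1) = - nu,
      \sum_(t <- U) sum_outgoing_slopes f (edge_point e t) = nu - mu &
      \sum_(t <- U) (sum_outgoing_slopes f (edge_point e t))%:~R * t =
        nu%:~R * len e - (f (inl (tgt e)) - f (inl (src e)))].
Proof.
move=> /(_ e)[s [s_path s_last s_aff]].
case Es: (size s) => [|N].
  by move: s_last; rewrite (size0nil Es) /= => /eqP; rewrite lt_eqF ?len_gt0.
have /choice[m hm] : forall i : nat, exists m : int, (i < size s)%N -> forall t,
    nth 0 (0 :: s) i <= t <= nth 0 s i ->
    (f \o edge_point e) t = (f \o edge_point e) (nth 0 (0 :: s) i)
      + m%:~R * (t - nth 0 (0 :: s) i).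
  by move=> i; case: (ltnP i (size s)) => [/s_aff[m hm]|_]; [exists m | exists 0].
pose b i := nth 0 (0 :: s) i.
have blt i j : (i < j <= N.+1)%N -> b i < b j.
  move=> /andP[ij jN]; apply: (sorted_ltn_nth lt_trans) => //; rewrite inE /= Es ltnS //.
  exact: leq_trans (ltnW ij) jN.
have b0 : b 0%N = 0 by [].
have bN : b N.+1 = len e by rewrite /b -Es -last_nth.
have haff i : (i <= N)%N -> forall t, b i <= t <= b i.+1 ->
    f (edge_point e t) = f (edge_point e (b i)) + (m i)%:~R * (t - b i).
  by move=> iN t ht; apply: (hm i) => //; rewrite Es.
have hr i t : (i <= N)%N -> b i <= t < b i.+1 -> outgoing_slope f e t 1 = m i.
  by move=> /haff/affine_slopes[h _]; apply: h.
have hl i t : (i <= N)%N -> b i < t <= b i.+1 -> outgoing_slope f e t (-1) = - m i.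
  by move=> /haff/affine_slopes[_ h]; apply: h.
have bint i : (0 < i <= N)%N -> 0 < b i < len e.
  move=> /andP[i0 iN]; rewrite -{1}b0 -bN.
  by apply/andP; split; apply: blt; rewrite ?i0 ?ltnS ?iN ?(leqW iN) ?leqnn.
have jump i : (0 < i <= N)%N ->
    sum_outgoing_slopes f (edge_point e (b i)) = m i - m i.-1.
  move=> hi; rewrite sum_outgoing_slopes_interior ?bint //.
  case/andP: hi; case: i => // i _ iN; rewrite (@hr i.+1) ?(@hl i) ?(ltnW iN) //=.
  - by rewrite lexx andbT blt // ltnSn leqW ?(ltnW iN).
  - by rewrite lexx blt // ltnSn ltnS iN.
pose U := [seq b i | i <- index_iota 1 N.+1].
have sumU (T : nmodType) (F : R -> T) : \sum_(t <- U) F t = \sum_(1 <= i < N.+1) F (b i).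
  by rewrite big_map.
exists (m 0%N), (m N), U; split.
- split; last by move=> t /mapP[i]; rewrite mem_index_iota ltnS => /bint h ->.
  rewrite map_inj_in_uniq ?iota_uniq // => i j; rewrite !mem_index_iota !ltnS.
  move=> /andP[_ iN] /andP[_ jN] bij; case: (ltngtP i j) => // ij.
  + by have := @blt i j; rewrite ij bij ltxx (leq_trans jN) // => /(_ isT).
  + by have := @blt j i; rewrite ij bij ltxx (leq_trans iN) // => /(_ isT).
- move=> t ht tU; rewrite sum_outgoing_slopes_interior //.
  case: (@bracket _ b N t) => [|i iN]; first by rewrite b0 bN; case/andP: ht => /ltW ->.
  rewrite le_eqVlt => /andP[/orP[/eqP bit|bit] tb]; last first.
    by rewrite (@hr i) ?(@hl i) ?subrr // ?bit ?(ltW bit) // ltW.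
  case: i iN bit tb => [|i] iN bit tb; first by move: ht; rewrite -bit b0 ltxx.
  by case/negP: tU; rewrite -bit map_f // mem_index_iota.
- split; first by apply: hr; rewrite // b0 lexx -b0 blt.
  by apply: hl; rewrite // bN lexx -bN blt // leqnn.
- have : forall k, (k <= N)%N -> \sum_(1 <= i < k.+1)
      sum_outgoing_slopes f (edge_point e (b i)) = m k - m 0%N.
    elim=> [|k IHk] kN; first by rewrite big_geq // subrr.
    by rewrite big_nat_recr //= IHk ?(ltnW kN) // jump //=; ring.
  by rewrite sumU; apply.
- have : forall k, (k <= N)%N -> \sum_(1 <= i < k.+1)
      (sum_outgoing_slopes f (edge_point e (b i)))%:~R * b i =
      (m k)%:~R * b k - (f (edge_point e (b k)) - f (edge_point e 0)).
    elim=> [|k IHk] kN; first by rewrite big_geq // b0 subrr mulr0 subrr.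
    rewrite big_nat_recr //= IHk ?(ltnW kN) // jump //= rmorphB /=.
    rewrite (haff k (ltnW kN) (b k.+1)); first by ring.
    by rewrite lexx ltW // blt // ltnSn leqW.
  rewrite sumU => -> //; rewrite edge_point0 -edge_point_len -bN.
  rewrite (haff N _ (b N.+1)) //; first by ring.
  by rewrite lexx ltW // blt // ltnSn.
Qed.

End Slopes.

Section PrincipalPairing.
Variables (R : realType) (G : metric_graph R).
Implicit Types (f : graph_point G -> R) (e : edge G) (D : divisor G).

(** [nu] gives the slopes of [f] at the ends of the edges and is chosen before [phi]. The jump [z e]
    lets [phi] be a coordinate on a circle, defined only up to full turns: it enters with an integer
    factor. *)
Lemma rational_pairing f D : rational_function f -> is_div f D ->
  exists nu : edge G -> int, forall (phi : graph_point G -> R) (c z : edge G -> R),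
    (forall e t, 0 < t < len e -> phi (edge_point e t) = phi (inl (src e)) + c e * t) ->
    (forall e, phi (inl (tgt e)) = phi (inl (src e)) + c e * len e + z e) ->
  pairing phi D =
    - \sum_e (c e * (f (inl (tgt e)) - f (inl (src e))) + (nu e)%:~R * z e).
Proof.
move=> f_rat f_div.
have /choice[mu /choice[nu /choice[U hU]]] := fun e => rational_edge_slopes e f_rat.
exists nu => phi c z phi_aff phi_tgt.
pose V := [seq inl v | v <- enum (vertex G)] ++
  flatten [seq [seq edge_point e t | t <- U e] | e <- enum (edge G)].
have U_int e t : t \in U e -> 0 < t < len e by case: (hU e) => -[_ h] *; apply: h.
rewrite (@pairingE _ _ V).
- rewrite big_cat /= big_map big_flatten /= big_map !big_enum /=.
  have -> : \sum_v (coeff (inl v) D)%:~R * phi (inl v) =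
      \sum_e ((mu e)%:~R * phi (inl (src e)) - (nu e)%:~R * phi (inl (tgt e))).
    rewrite sumrB (partition_big (@src _ G) xpredT) //=.
    rewrite [X in _ - X](partition_big (@tgt _ G) xpredT) //= -sumrB.
    apply: eq_bigr => v _; rewrite f_div /= rmorphD /= mulrDl !rmorph_sum /= !mulr_suml.
    rewrite -sumrN; congr (_ + _); apply: eq_bigr => e /eqP <-.
      by case: (hU e) => _ _ [-> _].
    by case: (hU e) => _ _ [_ ->] _ _; rewrite rmorphN mulNr.
  rewrite -big_split -sumrN; apply: eq_bigr => e _ /=; rewrite big_map phi_tgt.
  have -> : \sum_(t <- U e) (coeff (edge_point e t) D)%:~R * phi (edge_point e t) =
      phi (inl (src e)) * (\sum_(t <- U e) sum_outgoing_slopes f (edge_point e t))%:~R +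
      c e * \sum_(t <- U e) (sum_outgoing_slopes f (edge_point e t))%:~R * t.
    rewrite rmorph_sum !mulr_sumr -big_split /= !big_seq.
    by apply: eq_bigr => t tU; rewrite f_div phi_aff ?U_int //=; ring.
  by case: (hU e) => _ _ _ -> ->; rewrite rmorphB /=; ring.
- rewrite cat_uniq map_inj_uniq ?enum_uniq /=; last by move=> ? ? [].
  apply/andP; split.
    apply/hasPn => p /flattenP[_ /mapP[e _ ->] /mapP[t tU ->]].
    have [x -> _] := edge_point_interior (U_int _ _ tU).
    by apply/mapP => -[].
  elim: (enum _) (enum_uniq (edge G)) => //= e s IHs /andP[es us].
  rewrite cat_uniq IHs // andbT map_inj_in_uniq; last first.
    by move=> t t' /U_int ht /U_int ht' /(edge_point_inj ht ht')[].
  case: (hU e) => -[-> _] _ _ _ _ /=.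
  apply/hasPn => p /flattenP[_ /mapP[e' es' ->] /mapP[t' tU' ->]].
  apply/mapP => -[t tU] /(edge_point_inj (U_int _ _ tU') (U_int _ _ tU)) [ee' _].
  by rewrite -ee' es' in es.
- case=> [v|x]; first by rewrite mem_cat map_f ?mem_enum.
  rewrite -edge_point_inr mem_cat negb_or => /andP[_ xV]; rewrite f_div.
  case: (hU (val x).1) => _ h _ _ _; apply: h; first exact: (valP x).
  apply: contra xV => xU; apply/flattenP.
  exists [seq edge_point (val x).1 t | t <- U (val x).1]; last exact: map_f.
  by apply/mapP; exists (val x).1; rewrite // mem_enum.
Qed.

End PrincipalPairing.

(** * Rational functions with a prescribed divisor *)

Lemma gap_right (R : realDomainType) (X : seq R) t l : t < l ->
  exists2 b, t < b <= l & forall x, x \in X -> ~~ (t < x < b).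
Proof.
move=> tl; elim: X => [|y X [b /andP[tb bl] hb]]; first by exists l; rewrite ?tl /=.
case: (boolP (t < y < b)) => [/andP[ty yb]|hy].
  exists y; first by rewrite ty ltW // (lt_le_trans yb).
  move=> x; rewrite inE => /orP[/eqP->|/hb]; first by rewrite ltxx andbF.
  by apply: contra => /andP[-> xy]; rewrite (lt_trans xy).
exists b; first by rewrite tb.
by move=> x; rewrite inE => /orP[/eqP->|/hb].
Qed.

Lemma gap_left (R : realDomainType) (X : seq R) t l : l < t ->
  exists2 a, l <= a < t & forall x, x \in X -> ~~ (a < x < t).
Proof.
rewrite -ltrN2 => /(gap_right (map -%R X))[b /andP[tb bl] hb].
exists (- b); first by rewrite lerNr bl ltrNl.
move=> x xX; apply: contra (hb (- x) _); last exact: map_f.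
by rewrite ltrNl => /andP[-> h]; rewrite ltrN2 h.
Qed.

Section RationalWithDivisor.
Variables (R : realType) (G : metric_graph R).
Implicit Types (e : edge G) (D : divisor G) (p : graph_point G).

Definition on_edge e p : bool := if p is inr x then (val x).1 == e else false.

Definition abscissa p : R := if p is inr x then (val x).2 else 0.

Definition edge_mass e D : int := pairing (fun p => (on_edge e p)%:R) D.

Definition edge_moment e D : R := pairing (fun p => (on_edge e p)%:R * abscissa p) D.

Lemma abscissa_bound e p : on_edge e p -> 0 < abscissa p < len e.
Proof. by case: p => // x /= /eqP <-; apply: (valP x). Qed.

Lemma edge_pointK e p : on_edge e p -> edge_point e (abscissa p) = p.
Proof. by case: p => // x /= /eqP <-; apply: edge_point_inr. Qed.

(** [mu], [nu] and [F] are the first slopes, last slopes and vertex values of the function to be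
    built. The hypotheses are the two identities of [rational_edge_slopes] and the balance at each
    vertex. *)
Variables (D : divisor G) (mu nu : edge G -> int) (F : vertex G -> R).
Hypothesis nuE : forall e, nu e = mu e + edge_mass e D.
Hypothesis F_tgt : forall e,
  F (tgt e) - F (src e) = (nu e)%:~R * len e - edge_moment e D.
Hypothesis D_vertex : forall v,
  coeff (inl v) D = \sum_(e | src e == v) mu e - \sum_(e | tgt e == v) nu e.

Let mass_le e t : int := \sum_(p <- dom D | on_edge e p && (abscissa p <= t)) coeff p D.

(* The slope along e starts at mu e and increases by coeff p D at each p. *)
Let H e t : R := F (src e) + (mu e)%:~R * t +
  \sum_(p <- dom D | on_edge e p) (coeff p D)%:~R * Num.max 0 (t - abscissa p).

Let f p : R :=
  match p with inl v => F v | inr x => H (val x).1 (val x).2 end.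

Let edge_massE e : edge_mass e D = \sum_(p <- dom D | on_edge e p) coeff p D.
Proof.
rewrite big_mkcond; apply: eq_bigr => p _.
by case: ifP => _; rewrite ?mulr0 // mulr1 intz.
Qed.

Let edge_momentE e : edge_moment e D =
  \sum_(p <- dom D | on_edge e p) (coeff p D)%:~R * abscissa p.
Proof.
rewrite big_mkcond; apply: eq_bigr => p _.
by case: ifP => _; rewrite ?mul0r ?mulr0 // mul1r.
Qed.

Let H_affine e a b : (forall p, on_edge e p -> p \in dom D -> ~~ (a < abscissa p < b)) ->
  forall t, a <= t <= b -> H e t = H e a + (mu e + mass_le e a)%:~R * (t - a).
Proof.
move=> gap t /andP[ta tb].
have -> : (mu e + mass_le e a)%:~R * (t - a) = (mu e)%:~R * (t - a) +
    \sum_(p <- dom D | on_edge e p) (if abscissa p <= a then (coeff p D)%:~R * (t - a) else 0).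
  by rewrite rmorphD mulrDl /mass_le rmorph_sum mulr_suml big_mkcondr.
set S2 := \sum_(p <- _ | _) _.
suff hS : \sum_(p <- dom D | on_edge e p) (coeff p D)%:~R * Num.max 0 (t - abscissa p) =
  \sum_(p <- dom D | on_edge e p) (coeff p D)%:~R * Num.max 0 (a - abscissa p) + S2.
  by rewrite /H hS; ring.
rewrite -big_split big_seq_cond [RHS]big_seq_cond; apply: eq_bigr => p /andP[pD pe] /=.
case: (leP (abscissa p) a) => pa.
  by rewrite !max_r ?subr_ge0 ?(le_trans pa) //; ring.
have := gap p pe pD; rewrite pa /= -leNgt => bp.
by rewrite !max_l ?subr_le0 ?(ltW pa) ?(le_trans tb) // mulr0 addr0.
Qed.

(** At the far end of [e] every maximum is its second argument, and [F_tgt] says that the value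
    reached is the prescribed one. *)
Let f_edge e t : 0 <= t <= len e -> f (edge_point e t) = H e t.
Proof.
move=> /andP[]; rewrite le_eqVlt => /orP[/eqP <- _|t0].
  rewrite edge_point0 /f /H big1 ?mulr0 ?addr0 // => p /abscissa_bound /andP[p0 _].
  by rewrite max_l ?mulr0 // sub0r oppr_le0 ltW.
rewrite le_eqVlt => /orP[/eqP ->|tl]; last first.
  by case: (@edge_point_interior _ _ e t) => [|x -> /= ->]; rewrite ?t0.
rewrite edge_point_len /= /H -[LHS](subrK (F (src e))) F_tgt nuE edge_massE edge_momentE.
have -> : \sum_(p <- dom D | on_edge e p) (coeff p D)%:~R * Num.max 0 (len e - abscissa p) =
    (\sum_(p <- dom D | on_edge e p) coeff p D)%:~R * len e
    - \sum_(p <- dom D | on_edge e p) (coeff p D)%:~R * abscissa p.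
  rewrite rmorph_sum mulr_suml -sumrB; apply: eq_bigr => p /abscissa_bound /andP[_ pl].
  by rewrite max_r ?subr_ge0 ?(ltW pl) // mulrBr.
by rewrite rmorphD /=; ring.
Qed.

Let kinks e := [seq abscissa p | p <- dom D & on_edge e p].

Let kinksP e a b : (forall x, x \in kinks e -> ~~ (a < x < b)) ->
  forall p, on_edge e p -> p \in dom D -> ~~ (a < abscissa p < b).
Proof. by move=> gap p pe pD; apply/gap/map_f; rewrite mem_filter pe. Qed.

Let f_affine e a b : 0 <= a -> b <= len e -> (forall x, x \in kinks e -> ~~ (a < x < b)) ->
  forall t, a <= t <= b ->
    f (edge_point e t) = f (edge_point e a) + (mu e + mass_le e a)%:~R * (t - a).
Proof.
move=> a0 bl gap t /andP[ta tb].
rewrite !f_edge ?a0 ?(le_trans ta) ?(le_trans a0) ?(le_trans tb) //.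
by rewrite (H_affine (kinksP gap)) // ta.
Qed.

Let f_rational : rational_function f.
Proof.
move=> e; pose K := sort <=%R (undup (kinks e)).
have memK x : (x \in K) = (x \in kinks e) by rewrite mem_sort mem_undup.
have Kint x : x \in K -> 0 < x < len e.
  by rewrite memK => /mapP[p]; rewrite mem_filter => /andP[/abscissa_bound ? _] ->.
have K_path : path <%R 0 (rcons K (len e)).
  rewrite rcons_path path_min_sorted ?sort_lt_sorted ?undup_uniq /=; last first.
    by apply/allP => x /Kint /andP[].
  by have := mem_last 0 K; rewrite inE => /orP[/eqP ->|/Kint /andP[]]; rewrite ?len_gt0.
exists (rcons K (len e)); split; rewrite ?last_rcons // => i hi.
set s := rcons _ _ in hi *.
have nth_bound j : (j <= size s)%N -> 0 <= nth 0 (0 :: s) j <= len e.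
  move=> hj; have := mem_nth 0 (hj : (j < size (0%R :: s))%N).
  rewrite inE mem_rcons inE => /or3P[/eqP ->|/eqP ->|/Kint /andP[/ltW -> /ltW ->]] //.
    by rewrite lexx ltW ?len_gt0.
  by rewrite lexx ltW ?len_gt0.
have /andP[a0 _] := nth_bound i (ltnW hi).
have /andP[_ bl] := nth_bound i.+1 hi.
exists (mu e + mass_le e (nth 0 (0 :: s) i)); apply: f_affine => // x.
rewrite -memK => xK; apply/negP => /andP[].
have xs : x \in s by rewrite mem_rcons inE xK orbT.
have -> : x = nth 0 (0 :: s) (index x s).+1 by rewrite /= nth_index.
rewrite -[nth 0 s i]/(nth 0 (0 :: s) i.+1).
have s_sorted : sorted <%R (0 :: s) by [].
by rewrite !(lt_sorted_ltn_nth 0 s_sorted) ?inE /= ?ltnS ?index_mem // ?(ltnW hi) //; lia.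
Qed.

Let slope_right e t : 0 <= t < len e -> outgoing_slope f e t 1 = mu e + mass_le e t.
Proof.
move=> /andP[t0 /(gap_right (kinks e))[b /andP[tb bl] gap]].
by have [h _] := affine_slopes (f_affine t0 bl gap); apply: h; rewrite lexx.
Qed.

(** The inequality is strict: chips at [t] count on the right only, so the two outgoing slopes add
    up to the coefficient there. *)
Let slope_left e t : 0 < t <= len e -> outgoing_slope f e t (-1) =
  - (mu e + \sum_(p <- dom D | on_edge e p && (abscissa p < t)) coeff p D).
Proof.
move=> /andP[/(gap_left (kinks e))[a /andP[a0 at_] gap] tl].
have [_ h] := affine_slopes (f_affine a0 tl gap); rewrite h ?lexx ?at_ //.
congr (- (_ + _)); rewrite /mass_le big_seq_cond [RHS]big_seq_cond; apply: eq_bigl => p.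
case pD: (p \in dom D) => //=; case pe: (on_edge e p) => //=.
have := kinksP gap pe pD; case: (leP (abscissa p) a) => [pa _|pa] /=.
  by rewrite (le_lt_trans pa).
by move/negbTE->.
Qed.

Let f_div : is_div f D.
Proof.
case=> [v|x].
  rewrite D_vertex /= -sumrN; congr (_ + _); apply: eq_bigr => e _.
    rewrite slope_right ?lexx ?len_gt0 // /mass_le big1 ?addr0 //.
    by move=> p /andP[/abscissa_bound /andP[/lt_geF ->]].
  rewrite slope_left ?lexx ?len_gt0 // nuE edge_massE; congr (- (_ + _)).
  by apply: eq_bigl => p; case pe: (on_edge e p) => //; case/andP: (abscissa_bound pe).
have x_int := valP x; rewrite /= in x_int; have /andP[/ltW x0 /ltW xl] := x_int.
case/andP: (x_int) => xgt0 xltl.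
rewrite /= slope_right ?x0 // slope_left ?xgt0 // /mass_le; set e := (val x).1.
have -> : \sum_(p <- dom D | on_edge e p && (abscissa p <= (val x).2)) coeff p D =
    coeff (inr x) D + \sum_(p <- dom D | on_edge e p && (abscissa p < (val x).2)) coeff p D.
  rewrite (bigID (fun p => abscissa p == (val x).2)) /=; congr (_ + _); last first.
    by apply: eq_bigl => p; rewrite -andbA lt_neqAle [(_ <= _) && _]andbC.
  rewrite (eq_bigl (pred1 (inr x))); last first.
    move=> p; apply/idP/eqP => [/andP[/andP[pe _]] /eqP px|->]; last first.
      by rewrite /= !eqxx lexx.
    by rewrite -(edge_pointK pe) px edge_point_inr.
  rewrite big_mkcond -[RHS]intz -pairing_delta; apply: eq_bigr => p _ /=.
  by case: eqP; rewrite ?mulr0 // mulr1 intz.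
by ring.
Qed.

Lemma rational_with_divisor : exists2 f, rational_function f & is_div f D.
Proof. by exists f. Qed.

End RationalWithDivisor.

(** * Linear equivalence on a chain of cycles *)

Definition eqmod (R : realType) (l x y : R) : Prop := exists z : int, x - y = z%:~R * l.

Section EqMod.
Variables (R : realType) (l : R).
Implicit Types x y z : R.

Lemma eqmod_refl x : eqmod l x x.
Proof. by exists 0; rewrite subrr mul0r. Qed.

Lemma eqmod_sym x y : eqmod l x y -> eqmod l y x.
Proof. by case=> z h; exists (- z); rewrite rmorphN mulNr -h opprB. Qed.

Lemma eqmodD x y x' y' : eqmod l x y -> eqmod l x' y' -> eqmod l (x + x') (y + y').
Proof. by case=> z h [z' h']; exists (z + z'); rewrite rmorphD mulrDl -h -h'; ring. Qed.

Lemma eqmodN x y : eqmod l x y -> eqmod l (- x) (- y).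
Proof. by case=> z h; exists (- z); rewrite rmorphN mulNr -h; ring. Qed.

Lemma eqmodB x y x' y' : eqmod l x y -> eqmod l x' y' -> eqmod l (x - x') (y - y').
Proof. by move=> h /eqmodN; apply: eqmodD. Qed.

Lemma eqmod_trans x y z : eqmod l x y -> eqmod l y z -> eqmod l x z.
Proof. by case=> m h [m' h']; exists (m + m'); rewrite rmorphD mulrDl -h -h'; ring. Qed.

Lemma eqmodZ x y (m : int) : eqmod l x y -> eqmod l (x * m%:~R) (y * m%:~R).
Proof. by case=> z h; exists (z * m); rewrite -mulrBl h rmorphM /=; ring. Qed.

End EqMod.

Section Chain.
Variables (R : realType) (g : nat) (Gamma : chain_of_cycles R g).
Local Notation pt := (graph_point (chain_graph Gamma)).
Local Notation cdiv := (divisor (chain_graph Gamma)).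

(** Natural numbers index the cycles, for inductions along the chain; indices out of range fall back
    on the first cycle. *)
Definition cycle_of (n : nat) : 'I_g := insubd (Ordinal (genus_gt0 Gamma)) n.

Lemma cycle_ofK (i : 'I_g) : cycle_of i = i.
Proof. exact: valKd. Qed.

Lemma val_cycle_of n : (n < g)%N -> cycle_of n = n :> nat.
Proof. by move=> ng; rewrite /cycle_of val_insubd ng. Qed.

Definition arc_of n : R := arc_len Gamma (cycle_of n).
Definition loop_of n : R := cycle_len Gamma (cycle_of n).

Definition edge_index (e : chain_edge g) : nat :=
  match e with inl (i, _) => i | inr i => i end.

(* A bridge belongs to the cycle on its left. *)
Definition cycle_index (p : pt) : nat :=
  match p with
  | inl v => (v : chain_vertex g).1
  | inr x => edge_index (val x).1
  end.

(* The second arc runs from v to w in the negative direction. *)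
Definition position (p : pt) : R :=
  match p with
  | inl v => if (v : chain_vertex g).2 then arc_len Gamma (v : chain_vertex g).1 else 0
  | inr x => match ((val x).1 : chain_edge g) with
             | inl (_, b) => if b then - (val x).2 else (val x).2
             | inr i => arc_of i
             end
  end.

(* The coordinate, measured from v, of the retraction of p to the cycle n. *)
Definition proj n (p : pt) : R :=
  if (cycle_index p < n)%N then 0 else if (n < cycle_index p)%N then arc_of n else position p.

Lemma index_edge_point e t : 0 < t < len e -> cycle_index (edge_point e t) = edge_index e.
Proof. by move=> /(@edge_point_interior _ (chain_graph Gamma))[x -> /= ->]. Qed.

Lemma big_chain_edge (V : nmodType) (P : pred (chain_edge g)) (F : chain_edge g -> V) :
  \sum_(e | P e) F e =
  \sum_i ((if P (inl (i, false)) then F (inl (i, false)) else 0) +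
          (if P (inl (i, true)) then F (inl (i, true)) else 0)) +
  \sum_(j | P (inr j)) F (inr j).
Proof.
rewrite big_mkcond [X in _ + X]big_mkcond big_sumType /=; congr (_ + _).
transitivity (\sum_i \sum_b if P (inl (i, b)) then F (inl (i, b)) else 0).
  by rewrite pair_bigA; apply: eq_bigr => -[].
by apply: eq_bigr => i _; rewrite big_bool addrC.
Qed.

Lemma arc_edge_eqE (i j : 'I_g) (a b : bool) :
  ((inl (i, a) : chain_edge g) == inl (j, b)) = (i == j) && (a == b).
Proof. by []. Qed.

Lemma lin_equiv_deg (D1 D2 : cdiv) : lin_equiv D1 D2 -> deg D1 = deg D2.
Proof.
case=> f f_rat f_div; have [nu hnu] := rational_pairing f_rat f_div.
apply/eqP; rewrite -subr_eq0 -degB -(intr_eq0 R) -pairing1 pairing_intr.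
rewrite (hnu _ (fun=> 0) (fun=> 0)).
- by rewrite big1 ?oppr0 // => e _; rewrite mul0r mulr0 addr0.
- by move=> e t _; rewrite mul0r addr0.
- by move=> e; rewrite mul0r !addr0.
Qed.

Lemma lin_equiv_proj (D1 D2 : cdiv) n : lin_equiv D1 D2 -> (n < g)%N ->
  eqmod (loop_of n) (pairing (proj n) D1) (pairing (proj n) D2).
Proof.
case=> f f_rat f_div ng; have [nu hnu] := rational_pairing f_rat f_div.
pose i := cycle_of n.
have iE : i = n :> nat by exact: val_cycle_of.
(* [c] holds the slopes of [proj n]. Along the second arc it reaches w_n one full turn too low,
   hence the jump [z]. Both arcs have the same ends, so the [c] terms cancel and a multiple of the
   loop length remains. *)
pose c (e : chain_edge g) : R :=
  (e == inl (i, false))%:R - (e == inl (i, true))%:R.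
pose z (e : chain_edge g) : R := (e == inl (i, true))%:R * loop_of n.
exists (- nu (inl (i, true))); rewrite -pairingB (hnu _ c z).
- rewrite big_chain_edge [X in _ + X]big1 => [|j _]; last by rewrite /c /z /= subrr !mul0r mulr0 addr0.
  rewrite (bigD1 i) //= big1 => [|j ji]; last first.
    by rewrite /c /z !arc_edge_eqE (negbTE ji) /= subrr !mul0r !mulr0 !addr0.
  by rewrite /c /z !arc_edge_eqE eqxx /= rmorphN /=; ring.
- move=> e t ht; rewrite /proj (index_edge_point ht).
  have [x -> /= ->] := edge_point_interior ht.
  case: e {ht} => [[j b]|j] /=; last first.
    by rewrite /c subrr mul0r addr0 /arc_of (cycle_ofK (Ordinal (bridge_src_subproof j))).
  have ji : (j == i) = (j == n :> nat) by rewrite -iE.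
  case: (ltngtP j n) ji => [jn|nj|jn] ji; rewrite /c !arc_edge_eqE ji /=.
  + by rewrite subrr mul0r addr0.
  + by rewrite subrr mul0r addr0.
  + by case: b => /=; rewrite ?subr0 ?sub0r ?mulN1r ?mul1r add0r.
- case=> [[j b]|j] /=; rewrite /proj /=; last first.
    rewrite /c /z /= subrr !mul0r !addr0; case: (ltngtP j n) => jn.
    + by case: (ltngtP j.+1 n) => // jn'; rewrite ltnNge jn in jn'.
    + have -> : (j.+1 < n)%N = false by lia.
      by have -> : (n < j.+1)%N by lia.
    + have -> : (j.+1 < n)%N = false by lia.
      have -> : (n < j.+1)%N by lia.
      by rewrite /arc_of -jn (cycle_ofK (Ordinal (bridge_src_subproof j))).
  have ji : (j == i) = (j == n :> nat) by rewrite -iE.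
  case: (ltngtP j n) ji => [jn|nj|jn] ji; rewrite /c /z !arc_edge_eqE ji /=.
  + by rewrite subrr !mul0r !addr0.
  + by rewrite subrr !mul0r !addr0.
  + have -> : j = i by apply/eqP; rewrite ji.
    by case: b; rewrite /= ?subr0 ?sub0r ?mul0r ?mul1r ?mulN1r /loop_of -/i; ring.
Qed.

Definition chips_from n (D : cdiv) : int := pairing (fun p => (n <= cycle_index p)%N%:R) D.

Lemma cycle_index_lt p : (cycle_index p < g)%N.
Proof.
case: p => [[i b]|x] /=; first exact: ltn_ord.
case: (val x).1 => [[i b]|j] /=; first exact: ltn_ord.
exact: (bridge_src_subproof j).
Qed.

Lemma chips_from0 D : chips_from 0 D = deg D.
Proof. by rewrite -pairing1; apply: eq_pairing. Qed.

Lemma chips_from_ge n D : (g <= n)%N -> chips_from n D = 0.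
Proof.
move=> gn; rewrite /chips_from (eq_pairing (psi := fun=> 0)); last first.
  by move=> p; rewrite leqNgt (leq_trans (cycle_index_lt p) gn).
by rewrite /pairing big1 // => p _; rewrite mulr0.
Qed.

Lemma sum_src_v (V : nmodType) (F : chain_edge g -> V) i :
  \sum_(e | chain_src e == (i, false)) F e = F (inl (i, false)) + F (inl (i, true)).
Proof.
rewrite big_chain_edge /= [X in _ + X]big1 ?addr0 => [|j]; last by rewrite xpair_eqE andbF.
rewrite (bigD1 i) //= eqxx big1 ?addr0 // => j /negbTE ji.
by rewrite xpair_eqE ji addr0.
Qed.

Lemma sum_tgt_w (V : nmodType) (F : chain_edge g -> V) i :
  \sum_(e | chain_tgt e == (i, true)) F e = F (inl (i, false)) + F (inl (i, true)).
Proof.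
rewrite big_chain_edge /= [X in _ + X]big1 ?addr0 => [|j]; last by rewrite xpair_eqE andbF.
rewrite (bigD1 i) //= eqxx big1 ?addr0 // => j /negbTE ji.
by rewrite xpair_eqE ji addr0.
Qed.

Lemma sum_src_w (V : nmodType) (F : chain_edge g -> V) (i : 'I_g) :
  \sum_(e | chain_src e == (i, true)) F e = \sum_(j : 'I_g.-1 | j == i :> nat) F (inr j).
Proof.
rewrite big_chain_edge /= big1 ?add0r => [|j _]; last by rewrite xpair_eqE andbF addr0.
by apply: eq_bigl => j; rewrite xpair_eqE andbT -(inj_eq val_inj).
Qed.

Lemma sum_tgt_v (V : nmodType) (F : chain_edge g -> V) (i : 'I_g) :
  \sum_(e | chain_tgt e == (i, false)) F e = \sum_(j : 'I_g.-1 | j.+1 == i :> nat) F (inr j).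
Proof.
rewrite big_chain_edge /= big1 ?add0r => [|j _]; last by rewrite xpair_eqE andbF addr0.
by apply: eq_bigl => j; rewrite xpair_eqE andbT -(inj_eq val_inj).
Qed.

Lemma sum_bridge (V : nmodType) (h : nat -> V) n :
  \sum_(j : 'I_g.-1 | j.+1 == n) h j.+1 = if (0 < n < g)%N then h n else 0.
Proof.
case: n => [|n] /=; first by rewrite big1.
case: ltnP => ng; last first.
  by rewrite big1 // => j /eqP[jn]; have := ltn_ord j; rewrite jn ltn_predRL ltnNge ng.
have hn : (n < g.-1)%N by rewrite ltn_predRL.
by rewrite (big_pred1 (Ordinal hn)).
Qed.

(** * Divisors of degree zero with trivial coordinates are principal *)

Section Converse.
Variable D : cdiv.
Hypothesis D_deg : deg D = 0.
Variable z : nat -> int.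
Hypothesis D_proj : forall n, (n < g)%N -> pairing (proj n) D = (z n)%:~R * loop_of n.

Local Notation mass e := (edge_mass (G := chain_graph Gamma) e D).
Local Notation moment e := (edge_moment (G := chain_graph Gamma) e D).

Let bridge_mass n : int := \sum_(j : 'I_g.-1 | j == n :> nat) mass (inr j).

(** The chips that retract to w_i: at w_i, on the bridge after it, or further right. *)
Let tail (i : 'I_g) : int := chips_from i.+1 D + coeff (inl (i, true)) D + bridge_mass i.

(** Slopes forced by balance: a bridge carries the chips on its right, and the two arcs together
    carry [tail i]. How the arcs share it is fixed by the winding number [z i]. *)
Let nu (e : chain_edge g) : int :=
  match e with
  | inl (i, b) => if b then - z i else z i - tail i
  | inr j => - chips_from j.+1 D
  end.

Let mu e := nu e - mass e.

Let delta n : R := (nu (inl (cycle_of n, true)))%:~R * (loop_of n - arc_of n)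
  - moment (inl (cycle_of n, true)).

Let eta n : R := if insub n is Some j then
  (nu (inr j))%:~R * bridge_len Gamma j - moment (inr j) else 0.

(** Increments are summed from the left: [delta] over the second arc of each cycle, [eta] over the
    bridge after it. *)
Let F (v : chain_vertex g) : R :=
  \sum_(0 <= n < v.1) (delta n + eta n) + (if v.2 then delta v.1 else 0).

Let on_bridge (i : nat) (p : pt) : int :=
  \sum_(j : 'I_g.-1 | j == i :> nat) (on_edge (G := chain_graph Gamma) (inr j) p)%:R.

Let bridge_massE n : bridge_mass n = pairing (on_bridge n) D.
Proof.
rewrite /bridge_mass /edge_mass /pairing exchange_big /=.
by apply: eq_bigr => p _; rewrite mulr_sumr.
Qed.

Let on_bridge_inr (i : nat) (x : {x : chain_edge g * R | 0 < x.2 < chain_len Gamma x.1}) :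
  on_bridge i (inr x) = (if (val x).1 is inr j then (j == i :> nat)%:R else 0).
Proof.
rewrite /on_bridge /=; case: (val x).1 => [[k b]|j]; first by rewrite big1.
rewrite big_mkcond (bigD1 j) //= eqxx big1 ?addr0; first by case: eqP.
move=> k kj; case: eqP => // _; case: eqP => // -[jk].
by rewrite jk eqxx in kj.
Qed.

Let on_bridge_inl i v : on_bridge i (inl v) = 0.
Proof. by rewrite /on_bridge big1. Qed.

Let vertex_eqE (k i : 'I_g) (b c : bool) :
  ((inl (k, b) : pt) == inl (i, c)) = (k == i) && (b == c).
Proof. by []. Qed.

Lemma chips_from_split (i : 'I_g) : chips_from i D = coeff (inl (i, false)) D +
  mass (inl (i, false)) + mass (inl (i, true)) + tail i.
Proof.
rewrite -[coeff (inl (i, false)) _]intz /tail -[coeff (inl (i, true)) _]intz.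
rewrite -!pairing_delta bridge_massE -!pairing_split; apply: eq_pairing.
case=> [[k b]|x] /=.
  rewrite on_bridge_inl !vertex_eqE -(inj_eq val_inj) /=.
  by case: (ltngtP k i); case: b.
rewrite on_bridge_inr; case: (val x).1 => [[k b]|k] /=.
  by rewrite !arc_edge_eqE -(inj_eq val_inj) /=; case: (ltngtP k i); case: b.
by case: (ltngtP k i).
Qed.

Lemma proj_split (i : 'I_g) : pairing (proj i) D =
  arc_of i * (tail i)%:~R + moment (inl (i, false)) - moment (inl (i, true)).
Proof.
rewrite /tail -[coeff _ _]intz -pairing_delta bridge_massE.
rewrite -!pairing_split pairing_intr -pairing_scale -pairing_opp -!pairing_split.
apply: eq_pairing; case=> [[k b]|x] /=; rewrite /proj /=.
  rewrite on_bridge_inl vertex_eqE -(inj_eq val_inj) /= !mul0r subr0 !addr0.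
  case: (ltngtP k i) => [_|_|ki]; rewrite ?mulr0 ?mulr1 //.
  by case: b; rewrite ?mulr0 ?mulr1 // /arc_of -ki cycle_ofK.
rewrite on_bridge_inr; case: (val x).1 => [[k b]|k] /=.
  rewrite !arc_edge_eqE -(inj_eq val_inj) /=.
  case: (ltngtP k i) => [_|_|ki]; rewrite ?mulr0 ?mulr1 ?mul0r ?addr0 ?subr0 //.
  by case: b; rewrite /= ?mul0r ?mul1r ?addr0 ?add0r ?subr0.
by case: (ltngtP k i) => [_|_|->]; rewrite ?mulr0 ?mulr1 ?mul0r ?addr0 ?subr0.
Qed.

Lemma principal_of_proj : exists2 f, rational_function f & is_div f D.
Proof.
apply: (@rational_with_divisor _ (chain_graph Gamma) D mu nu F).
- by move=> e; rewrite /mu subrK.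
- case=> [[i b]|j] /=.
    rewrite /F /= addr0 addrAC subrr add0r /delta cycle_ofK.
    rewrite /loop_of /arc_of cycle_ofK; case: b; first reflexivity.
    (* The first arc must give the same increment from v to w as the second one; this is the
       coordinate equation. *)
    have /esym/eqP := D_proj (ltn_ord i).
    rewrite proj_split /loop_of /arc_of cycle_ofK rmorphB rmorphN /= -subr_eq0 => /eqP hz.
    apply: subr0_eq; rewrite -oppr0 -hz.
    by move: (moment _) (moment (inl (i, true))) => m m'; ring.
  rewrite /F /= addr0 big_nat_recr //= /eta valK -[- chips_from _ _]/(nu (inr j)); ring.
- change (forall v : chain_vertex g, coeff (inl v) D =
    \sum_(e | chain_src e == v) mu e - \sum_(e | chain_tgt e == v) nu e).
  case=> i [].
    have bridge_i (h : nat -> int) : \sum_(j : 'I_g.-1 | j == i :> nat) h j.+1 =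
      if (i.+1 < g)%N then h i.+1 else 0 := sum_bridge h i.+1.
    rewrite sum_src_w sum_tgt_w /mu /= sumrB sumrN (bridge_i (fun n => chips_from n D)).
    rewrite -/(bridge_mass i) /tail; case: ltnP => [_|/chips_from_ge ->]; ring.
  rewrite sum_src_v sum_tgt_v /mu /= sumrN (sum_bridge (fun n => chips_from n D)) ltn_ord andbT.
  (* No bridge ends at the first cycle; the missing term is the degree, which is zero. *)
  have -> : (if (0 < i)%N then chips_from i D else 0) = chips_from i D.
    by case: i => -[|i] hi //=; rewrite chips_from0 D_deg.
  rewrite chips_from_split; move: (coeff _ _) (mass _) (mass (inl (i, true))) (tail i) (z i) => c m m' t w.
  by ring.
Qed.

End Converse.

(** Abel-Jacobi for the chain: the Jacobian is the product of the circles, and bridges contribute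
    nothing. *)
Lemma lin_equivP (D1 D2 : cdiv) : lin_equiv D1 D2 <->
  deg D1 = deg D2 /\ forall n, (n < g)%N ->
    eqmod (loop_of n) (pairing (proj n) D1) (pairing (proj n) D2).
Proof.
split=> [h|[hdeg hproj]].
  by split; [apply: lin_equiv_deg | move=> n; apply: lin_equiv_proj].
have /choice[z hz] : forall n, exists z : int, (n < g)%N ->
    pairing (proj n) (D1 - D2) = z%:~R * loop_of n.
  move=> n; case: (ltnP n g) => [/hproj[z hz]|_]; last by exists 0.
  by exists z => _; rewrite pairingB.
by apply: principal_of_proj hz; rewrite degB hdeg subrr.
Qed.

End Chain.

(** * Effective divisors on a chain of cycles *)

Section Level.
Variables (R : realType) (g : nat) (Gamma : chain_of_cycles R g).
Local Notation pt := (graph_point (chain_graph Gamma)).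
Local Notation cdiv := (divisor (chain_graph Gamma)).
Local Notation arc_of := (arc_of Gamma).
Local Notation loop_of := (loop_of Gamma).

Definition cproj n (D : cdiv) : R := pairing (@proj _ _ Gamma n) D.

(** If [y] chips are available, all of them can then be placed at w_n or beyond. *)
Definition good (D : cdiv) n (y : int) : bool :=
  `[< eqmod (loop_of n) (cproj n D) (arc_of n * y%:~R) >].

Fixpoint level (D : cdiv) n : int :=
  if n is m.+1 then level D m - 1 + (good D m (level D m))%:R else deg D.

Lemma levelS D n : level D n.+1 = level D n - 1 + (good D n (level D n))%:R.
Proof. by []. Qed.

Lemma effective_pairing_ge0 (phi : pt -> int) (E : cdiv) :
  effective E -> (forall p, 0 <= phi p) -> 0 <= pairing phi E.
Proof. by move=> hE h; apply: sumr_ge0 => p _; rewrite intz mulr_ge0. Qed.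

Lemma chips_from_diff n (E : cdiv) :
  chips_from n E - chips_from n.+1 E = pairing (fun p => (cycle_index p == n)%:R) E.
Proof.
rewrite /chips_from -pairing_opp -pairing_split; apply: eq_pairing => p.
by case: (ltngtP n (cycle_index p)).
Qed.

Lemma chips_from_noninc n (E : cdiv) : effective E -> chips_from n.+1 E <= chips_from n E.
Proof.
by move=> hE; rewrite -subr_ge0 chips_from_diff effective_pairing_ge0 // => p; case: (_ == _).
Qed.

(** Equal counts and nonnegative coefficients leave no chip of index n; every other chip has
    coordinate 0 or that of w_n. *)
Lemma effective_cproj n (E : cdiv) : effective E -> chips_from n E = chips_from n.+1 E ->
  cproj n E = arc_of n * (chips_from n.+1 E)%:~R.
Proof.
move=> hE /eqP; rewrite -subr_eq0 chips_from_diff /cproj /chips_from pairing_intr -pairing_scale.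
rewrite /pairing psumr_eq0 => [/allP h|p _]; last first.
  by rewrite intz mulr_ge0 //; case: (_ == _).
rewrite !big_seq; apply: eq_bigr => p pE; have := h p pE; rewrite /proj /= intz mulf_eq0.
case: ltngtP => ip /=; rewrite ?mulr0 ?mulr1 //.
by rewrite orbF => /eqP ->; rewrite mul0r.
Qed.

(** A cycle where the count does not drop carries no chip. If the bound is tight there,
    [effective_cproj] makes the level good; otherwise there is room for the loss of one. *)
Lemma chips_from_le_level (D D' : cdiv) n : effective D' -> lin_equiv D' D -> (n <= g)%N ->
  chips_from n D' <= level D n.
Proof.
move=> hD' /lin_equivP[hdeg hproj]; elim: n => [|n IHn] ng; first by rewrite chips_from0 hdeg.
have := IHn (ltnW ng); have := chips_from_noninc n hD'; rewrite levelS.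
rewrite le_eqVlt => /orP[/eqP eqr|ltr] hle.
  move: hle; rewrite le_eqVlt => /orP[/eqP eql|]; last by case: (good _ _ _); lia.
  suff -> : good D n (level D n) by lia.
  apply/asboolP; rewrite -eql -eqr -effective_cproj //.
  exact/eqmod_sym/hproj.
by case: (good _ _ _); lia.
Qed.

Lemma arc_gt0 n : 0 < arc_of n. Proof. exact: arc_len_gt0. Qed.
Lemma arc_lt_loop n : arc_of n < loop_of n. Proof. exact: arc_len_lt. Qed.

Lemma point_at n (x : R) : (n < g)%N ->
  exists q : pt, cycle_index q = n /\ eqmod (loop_of n) (position q) x.
Proof.
move=> ng; have l0 : 0 < loop_of n := lt_trans (arc_gt0 n) (arc_lt_loop n).
pose y := x - (Num.floor (x / loop_of n))%:~R * loop_of n.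
have xy : eqmod (loop_of n) y x.
  by exists (- Num.floor (x / loop_of n)); rewrite /y rmorphN mulNr; ring.
have y0 : 0 <= y by rewrite subr_ge0 -ler_pdivlMr // floor_le.
have yl : y < loop_of n.
  have := floorD1_gt (x / loop_of n); rewrite ltr_pdivrMr // rmorphD /= /y; lra.
have in_ := val_cycle_of Gamma ng.
move: y0; rewrite le_eqVlt => /orP[/eqP y0|y0].
  by exists (inl (cycle_of Gamma n, false)); rewrite /= y0.
case: (ltgtP y (arc_of n)) => ya.
- have hy : 0 < y < len (inl (cycle_of Gamma n, false) : edge (chain_graph Gamma)).
    by rewrite y0.
  have [q qE qv] := edge_point_interior hy.
  by exists (inr q); rewrite /= qv /=.
(* The second arc is measured from v against the orientation, so the residue y lies at distance l -
   y. *)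
- have hy : 0 < loop_of n - y < len (inl (cycle_of Gamma n, true) : edge (chain_graph Gamma)).
    by rewrite subr_gt0 yl /= ltrD2l ltrN2.
  have [q qE qv] := edge_point_interior hy.
  exists (inr q); rewrite /= qv /=; split=> //; apply: eqmod_trans xy.
  by exists (-1); ring.
- by exists (inl (cycle_of Gamma n, true)); rewrite /= -/(arc_of n) -ya.
Qed.

Lemma level_noninc (D : cdiv) n : level D n.+1 <= level D n.
Proof. by rewrite levelS; case: (good _ _ _); lia. Qed.

Lemma level_sum (D : cdiv) n : (n <= g)%N ->
  \sum_(n <= m < g) (level D m - level D m.+1) = level D n - level D g.
Proof.
move=> ng; rewrite (telescope_sumr_eq (fun m => - level D m)) //; first by ring.
by move=> m _; ring.
Qed.

(** Greedy representative: a cycle that is not good receives one chip, at the point [q n] correcting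
    its coordinate; the [level D g] chips left over go to the last w. *)
Lemma effective_of_level (D : cdiv) : 0 <= level D g ->
  exists2 D' : cdiv, effective D' & lin_equiv D' D.
Proof.
move=> hD.
have /choice[q hq] : forall n, exists q : pt, (n < g)%N -> cycle_index q = n /\
    eqmod (loop_of n) (position q) (cproj n D - arc_of n * (level D n.+1)%:~R).
  move=> n; case: (ltnP n g) => [ng|_].
    by have [q hq] := point_at (cproj n D - arc_of n * (level D n.+1)%:~R) ng; exists q.
  by exists (inl (Ordinal (genus_gt0 Gamma), true)).
pose w : pt := inl (cycle_of Gamma g.-1, true).
have g0 := genus_gt0 Gamma.
have w_index : cycle_index w = g.-1 by rewrite /= val_cycle_of // ltn_predL.
exists (\sum_(0 <= m < g) << level D m - level D m.+1 *g q m >> + << level D g *g w >>).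
  move=> p; rewrite coeffD addr_ge0 //; last by rewrite coeffU mulr_ge0 //; case: (_ == _).
  rewrite raddf_sum sumr_ge0 //= => m _.
  by rewrite coeffU mulr_ge0 ?subr_ge0 ?level_noninc //; case: (_ == _).
apply/lin_equivP; split.
  rewrite degD degU raddf_sum /= (eq_bigr _ (fun m _ => degU _ _)).
  by rewrite level_sum // subrK.
move=> n ng; rewrite pairingD pairing_sum pairingU (big_cat_nat (n := n)) ?(ltnW ng) //=.
rewrite big_nat big1 => [|m /andP[_ mn]]; last first.
  by rewrite pairingU /proj (hq m (ltn_trans mn ng)).1 mn mulr0.
rewrite add0r big_ltn // pairingU.
have -> : \sum_(n.+1 <= m < g) pairing (@proj _ _ Gamma n) << level D m - level D m.+1 *g q m >> =
    arc_of n * (\sum_(n.+1 <= m < g) (level D m - level D m.+1))%:~R.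
  rewrite rmorph_sum mulr_sumr; apply: eq_big_nat => m /andP[nm mg].
  by rewrite pairingU /proj (hq m mg).1 nm ltnNge (ltnW nm) mulrC.
rewrite level_sum // /proj (hq n ng).1 ltnn w_index.
have -> : (if (g.-1 < n)%N then 0 else if (n < g.-1)%N then arc_of n else position w) = arc_of n.
  case: (ltngtP n g.-1) => // [|nE]; first by lia.
  by rewrite /= -nE.
have [z hz] := (hq n ng).2.
have := levelS D n; rewrite -/(cproj n D) /good.
case: asboolP => [[z' hz']|_] lS.
  exists (- z'); rewrite rmorphN mulNr -hz' lS !(rmorphB, rmorphD) /=; ring.
exists z; rewrite -hz lS !(rmorphB, rmorphD) /=; ring.
Qed.

End Level.

(** * Rank and gonality *)

Section Rank.
Variables (R : realType) (g : nat) (Gamma : chain_of_cycles R g).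
Local Notation pt := (graph_point (chain_graph Gamma)).
Local Notation cdiv := (divisor (chain_graph Gamma)).

Definition winning (D : cdiv) r :=
  forall E : cdiv, effective E -> deg E = r%:Z -> 0 <= level (D - E) g.

Lemma effectiveD (D E : cdiv) : effective D -> effective E -> effective (D + E).
Proof. by move=> hD hE p; rewrite coeffD addr_ge0. Qed.

Lemma effectiveU (c : int) (p : pt) : 0 <= c -> effective (<< c *g p >> : cdiv).
Proof. by move=> c0 q; rewrite coeffU mulr_ge0 //; case: (_ == _). Qed.

Lemma lin_equiv_shift (D1 D2 E1 E2 : cdiv) : D1 - D2 = E1 - E2 ->
  lin_equiv D1 D2 -> lin_equiv E1 E2.
Proof. by move=> e [f f_rat f_div]; exists f; rewrite // -e. Qed.

Lemma lin_equiv_sym (D1 D2 : cdiv) : lin_equiv D1 D2 -> lin_equiv D2 D1.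
Proof.
by move/lin_equivP=> [hdeg h]; apply/lin_equivP; split=> // n ng; apply/eqmod_sym/h.
Qed.

Lemma rank_atleastP (D : cdiv) r : rank_atleast D r <-> winning D r.
Proof.
split=> h E hE dE.
  have [D' [hD' D'D hD'E]] := h E hE dE.
  rewrite -(chips_from_ge (D' - E) (leqnn g)); apply: chips_from_le_level => //.
  by apply: lin_equiv_shift D'D; rewrite opprB addrA subrK.
have [D' hD' D'D] := effective_of_level (h E hE dE).
exists (D' + E); split; [exact: effectiveD | | by rewrite addrK].
by apply: lin_equiv_shift D'D; rewrite opprB addrA addrAC.
Qed.

Let p0 : pt := inl (Ordinal (genus_gt0 Gamma), false).

Lemma effective_deg_ge0 (D : cdiv) : effective D -> 0 <= deg D.
Proof. by move=> hD; rewrite -pairing1 effective_pairing_ge0. Qed.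

Lemma rank_atleast_deg (D : cdiv) r : rank_atleast D r -> r%:Z <= deg D.
Proof.
move=> /(_ << r%:Z *g p0 >>)[||D' [_ /lin_equiv_deg <- hE]].
- exact: effectiveU.
- by rewrite degU.
by have := effective_deg_ge0 hE; rewrite degB degU subr_ge0.
Qed.

Lemma rank_atleast_le (D : cdiv) r s : (r <= s)%N -> rank_atleast D s -> rank_atleast D r.
Proof.
move=> rs h E hE dE.
have hp : effective (<< (s - r)%N%:Z *g p0 >> : cdiv) by exact: effectiveU.
have [||D' [hD' D'D hD'E]] := h (E + << (s - r)%N%:Z *g p0 >>); first exact: effectiveD.
  by rewrite degD degU dE -PoszD subnKC.
exists D'; split=> //; rewrite -[D' - E](subrK << (s - r)%N%:Z *g p0 >>).
by apply: effectiveD => //; rewrite -addrA -opprD.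
Qed.

(** The degree bounds the r with [rank_atleast D r], so the maximum in [rank] exists; [0 < r]
    excludes the default value of [xget]. *)
Lemma rank_ge (D : cdiv) r : (0 < r)%N -> r%:Z <= rank D <-> rank_atleast D r.
Proof.
move=> r0; rewrite /rank; split.
  case: asboolP => _ //; case: xgetP => [s _ [hs _]|_]; last by rewrite lez_nat leqNgt r0.
  by rewrite lez_nat => rs; apply: rank_atleast_le hs.
move=> hr; case: asboolP => [_|[]]; last first.
  have [||D' [hD' /lin_equiv_sym D'D _]] := hr << r%:Z *g p0 >>; [exact: effectiveU | exact: degU |].
  by exists D'.
have bound s : `[< rank_atleast D s >] -> (s <= `|deg D|)%N.
  by move=> /asboolP/rank_atleast_deg; lia.
have ex : exists s, `[< rank_atleast D s >] by exists r; apply/asboolP.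
case: (ex_maxnP ex bound) => s /asboolP hs smax.
case: xgetP => [t _ [_ ht]|/(_ s)[]]; first by rewrite lez_nat ht.
by split=> // t /asboolP; apply: smax.
Qed.

Lemma gonalityI r n : (0 < r)%N ->
  (exists2 D : cdiv, deg D = n & winning D r) ->
  (forall D : cdiv, winning D r -> n <= deg D) ->
  is_gonality (chain_graph Gamma) r n.
Proof.
move=> r0 [D dD hD] hn; split.
  by exists D; split=> //; apply/rank_ge/rank_atleastP.
by move=> D' /(rank_ge D' r0)/rank_atleastP/hn.
Qed.

End Rank.

(** * Divisors of large rank *)

Section Existence.
Variables (R : realType) (g : nat) (Gamma : chain_of_cycles R g).
Local Notation pt := (graph_point (chain_graph Gamma)).
Local Notation cdiv := (divisor (chain_graph Gamma)).
Local Notation arc_of := (arc_of Gamma).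
Local Notation loop_of := (loop_of Gamma).

Definition vpt n : pt := inl (cycle_of Gamma n, false).
Definition wpt n : pt := inl (cycle_of Gamma n, true).

Lemma proj_vpt n m : (m < g)%N -> proj n (vpt m) = if (n < m)%N then arc_of n else 0.
Proof. by move=> mg; rewrite /proj /= val_cycle_of //; case: ltngtP. Qed.

Lemma proj_wpt n m : (m < g)%N -> proj n (wpt m) = if (n <= m)%N then arc_of n else 0.
Proof. by move=> mg; rewrite /proj /= val_cycle_of //; case: ltngtP => // ->. Qed.

(** On such divisors every coordinate is an integer multiple of the arc, so goodness can be read on
    integers. *)
Definition vw_div (c d : nat -> int) : cdiv :=
  \sum_(0 <= m < g) (<< c m *g vpt m >> + << d m *g wpt m >>).

Lemma deg_vw_div c d : deg (vw_div c d) = \sum_(0 <= m < g) (c m + d m).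
Proof. by rewrite raddf_sum; apply: eq_bigr => m _; rewrite /= degD !degU. Qed.

Lemma cproj_vw_div c d n : (n < g)%N ->
  cproj n (vw_div c d) = arc_of n * (d n + \sum_(n.+1 <= m < g) (c m + d m))%:~R.
Proof.
move=> ng; rewrite /cproj pairing_sum (big_cat_nat (n := n)) ?(ltnW ng) //=.
rewrite big_nat big1 => [|m /andP[_ mn]]; last first.
  have mg := ltn_trans mn ng.
  by rewrite pairingD !pairingU proj_vpt // proj_wpt // ltnNge (ltnW mn) /= leqNgt mn !mulr0 addr0.
rewrite add0r big_ltn // pairingD !pairingU proj_vpt // proj_wpt // ltnn leqnn mulr0 add0r.
rewrite rmorphD mulrDr mulrC; congr (_ + _); rewrite rmorph_sum mulr_sumr.
apply: eq_big_nat => m /andP[nm mg]; rewrite pairingD !pairingU proj_vpt // proj_wpt //.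
by rewrite nm (ltnW nm) rmorphD /=; ring.
Qed.

(* The chips of E on the cycles >= n do not affect the cycles on their left, so
   they are added back. *)
Definition surplus (D E : cdiv) n : int := level (D - E) n + chips_from n E.

Lemma surplus0 (D E : cdiv) : surplus D E 0 = deg D.
Proof. by rewrite /surplus /= chips_from0 degB subrK. Qed.

Lemma surplus_end (D E : cdiv) : surplus D E g = level (D - E) g.
Proof. by rewrite /surplus chips_from_ge ?addr0. Qed.

Lemma surplus_step (D E : cdiv) n :
  surplus D E n - 1 - (chips_from n E - chips_from n.+1 E) <= surplus D E n.+1.
Proof. by rewrite /surplus levelS; case: (good _ _ _); lia. Qed.

Lemma surplus_step_good (D E : cdiv) n : effective E -> chips_from n E = chips_from n.+1 E ->
  eqmod (loop_of n) (cproj n D) (arc_of n * (surplus D E n)%:~R) ->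
  surplus D E n.+1 = surplus D E n.
Proof.
move=> hE eqr hn; suff gd : good (D - E) n (level (D - E) n).
  by rewrite /surplus levelS gd eqr; lia.
apply/asboolP; rewrite /cproj pairingB -!/(cproj _ _) (effective_cproj hE eqr).
have := eqmodB hn (eqmod_refl (loop_of n) (arc_of n * (chips_from n.+1 E)%:~R)).
by rewrite -mulrBr -intrB /surplus eqr addrK.
Qed.

(** Each of the g cycles costs at most one chip. *)
Lemma winning_of_deg (D : cdiv) r : deg D = r%:Z + g%:Z -> winning D r.
Proof.
move=> dD E hE dE; have h n : deg (D - E) - n%:Z <= level (D - E) n.
  by elim: n => [|n IHn]; rewrite ?levelS /= ?subr0 //; case: (good _ _ _); lia.
by have := h g; rewrite degB dD dE; lia.
Qed.

(** The witness is the canonical divisor, one chip at every v and w except the first v and the last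
    w, minus g - 1 - r chips at the last w. *)
Lemma winning_canonical r : (r < g)%N ->
  exists2 D : cdiv, deg D = r%:Z + g%:Z - 1 & winning D r.
Proof.
move=> rg; have g0 : (0 < g)%N by lia.
pose c n : int := if n == 0%N then 0 else 1.
pose d n : int := if n == g.-1 then r%:Z - g%:Z + 1 else 1.
have sum_tail n : (n < g)%N -> d n + \sum_(n.+1 <= m < g) (c m + d m) = g%:Z - n%:Z *+ 2 - 1 + r%:Z.
  move=> ng; have [k gE] : exists k, g = (n + k).+1 by exists (g - n.+1)%N; lia.
  elim: k n ng gE => [|k IHk] n ng gE.
    by rewrite big_geq ?addr0; [rewrite /d; case: eqP; lia | lia].
  rewrite big_ltn; last by lia.
  have -> : d n = 1 by rewrite /d; case: eqP; lia.
  have -> : c n.+1 = 1 by [].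
  by rewrite -[_ + _ + \sum_(_ <= _ < _) _]addrA IHk; lia.
have deg_c : deg (vw_div c d) = r%:Z + g%:Z - 1.
  by rewrite deg_vw_div big_ltn // (_ : c 0%N = 0) // add0r sum_tail //; lia.
exists (vw_div c d) => //.
move=> E hE dE; rewrite -surplus_end.
(* One chip is missing while [E] has at least n chips on the first n cycles. As r < g this ends, at
   a cycle n free of [E] with exactly n chips of [E] before it; if the bound is tight there, that
   cycle is crossed for free. *)
suff inv n : (n <= g)%N -> g%:Z - n%:Z + chips_from n E -
    (if n%:Z <= r%:Z - chips_from n E then 1 else 0) <= surplus (vw_div c d) E n.
  by have := inv g (leqnn g); rewrite chips_from_ge //; case: ifP; lia.
elim: n => [|n IHn] ng.
  by rewrite surplus0 chips_from0 deg_c dE subrr lexx; lia.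
have := IHn (ltnW ng); have := surplus_step (vw_div c d) E n; have := chips_from_noninc n hE.
have good_step : chips_from n E = chips_from n.+1 E ->
    surplus (vw_div c d) E n = g%:Z - n%:Z *+ 2 - 1 + r%:Z ->
    surplus (vw_div c d) E n.+1 = surplus (vw_div c d) E n.
  by move=> eqr hs; apply: surplus_step_good => //; rewrite hs cproj_vw_div // sum_tail //; apply: eqmod_refl.
case: (eqVneq (chips_from n E) (chips_from n.+1 E)) good_step => [-> /(_ erefl)|neq _].
  case: (eqVneq (surplus (vw_div c d) E n) (g%:Z - n%:Z *+ 2 - 1 + r%:Z)) => [-> /(_ erefl) ->|].
    by case: ifP; case: ifP; lia.
  by case: ifP; case: ifP; lia.
by case: ifP; case: ifP; lia.
Qed.

(** The witness has 2r chips at the first w and one chip at v on each exceptional cycle. *)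
Lemma winning_special (J : pred nat) r : (0 < g)%N -> ~~ J 0%N ->
  (forall n, (0 < n < g)%N -> ~~ J n -> eqmod (loop_of n) (arc_of n * 2) 0) ->
  exists2 D : cdiv, deg D = (\sum_(0 <= m < g) J m)%N%:Z + 2 * r%:Z & winning D r.
Proof.
move=> g0 J0 hJ.
pose c n : int := (J n)%:R.
pose d n : int := if n == 0%N then 2 * r%:Z else 0.
pose S n : int := \sum_(n <= m < g) c m.
have sumS n : (0 < n)%N -> \sum_(n <= m < g) (c m + d m) = S n.
  move=> n0; apply: eq_big_nat => m /andP[nm _].
  by rewrite /d eqn0Ngt (leq_trans n0 nm) addr0.
have S_step n : (n < g)%N -> S n = c n + S n.+1 by move=> ng; rewrite /S big_ltn.
have c0 : c 0%N = 0 by rewrite /c (negbTE J0).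
have deg_c : deg (vw_div c d) = S 0%N + 2 * r%:Z.
  by rewrite deg_vw_div [LHS]big_ltn // sumS // (S_step 0%N) // c0 !add0r addrC.
exists (vw_div c d).
  by rewrite deg_c; congr (_ + _); rewrite -[RHS]natz natr_sum.
move=> E hE dE; rewrite -surplus_end.
(* Each chip of [E] to come is charged twice, for itself and for its cycle, and [S n] pays for the
   exceptional cycles ahead. An ordinary cycle free of [E] costs nothing in the tight case, pairs of
   chips being invisible to it. *)
suff inv n : (n <= g)%N -> chips_from n E *+ 2 + S n <= surplus (vw_div c d) E n.
  by apply: le_trans (inv g (leqnn g)); rewrite chips_from_ge // /S big_geq.
elim: n => [|n IHn] ng.
  by rewrite surplus0 chips_from0 deg_c dE; lia.
have := IHn (ltnW ng); have := surplus_step (vw_div c d) E n; have := chips_from_noninc n hE.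
rewrite (S_step n) //.
case Jn: (J n); first by rewrite /c Jn; lia.
have cn : c n = 0 by rewrite /c Jn.
have good_step : chips_from n E = chips_from n.+1 E ->
    surplus (vw_div c d) E n = chips_from n E *+ 2 + S n ->
    surplus (vw_div c d) E n.+1 = surplus (vw_div c d) E n.
  move=> eqr hs; apply: surplus_step_good => //; rewrite hs cproj_vw_div // sumS // (S_step n) // cn add0r.
  rewrite rmorphD [in X in eqmod _ _ X]rmorphD !mulrDr; apply: eqmodD; last exact: eqmod_refl.
  (* On the first cycle the two sides are equal outright, since [E] has exactly r chips; elsewhere
     the torsion is used. *)
  rewrite /d; case: n {IHn cn} ng Jn eqr hs => [|n] ng Jn eqr hs /=.
    by rewrite chips_from0 dE mulr2n mulrDl mul1r; apply: eqmod_refl.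
  rewrite mulr0 -mulr_natr rmorphM /= [_ * 2%:R]mulrC mulrA -[X in eqmod _ X](mul0r (chips_from n.+1 E)%:~R).
  by apply/eqmodZ/eqmod_sym/hJ; rewrite ?Jn.
case: (eqVneq (chips_from n E) (chips_from n.+1 E)) good_step => [-> /(_ erefl)|neq _]; last by lia.
case: (eqVneq (surplus (vw_div c d) E n) (chips_from n.+1 E *+ 2 + S n)) => [->|].
  move=> /(_ erefl) ->; rewrite S_step //; lia.
rewrite S_step //; lia.
Qed.

End Existence.

(** * Combinatorial bound *)

Section Gains.
Variables (G : nat -> int -> bool) (d : int).

(* [G n y] means that y chips can cross the cycle n at no cost, and e is the number
   of chips spent by the adversary: the state of the game with e chips spent is
   d - e - n + gain n e. *)
Fixpoint gain n e : nat :=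
  if n is m.+1 then
    let x := (gain m e + G m (d - e%:Z - m%:Z + (gain m e)%:Z))%N in
    if e is e'.+1 then minn x (gain m e') else x
  else 0%N.

(** The minimum is the adversary's choice: leave the cycle n alone, or spend a chip there and make
    it costly. *)
Lemma gainSS n e : gain n.+1 e.+1 =
  minn (gain n e.+1 + G n (d - e.+1%:Z - n%:Z + (gain n e.+1)%:Z)) (gain n e).
Proof. by []. Qed.

Lemma gain_succ_le n e : (gain n.+1 e <= (gain n e).+1)%N.
Proof. by case: e => [|e] /=; case: (G _ _); lia. Qed.

Lemma gain_diag_le n e : (gain n.+1 e.+1 <= gain n e)%N.
Proof. by rewrite /= geq_minr. Qed.

Lemma gain_mono n e : (gain n e <= gain n.+1 e)%N /\ (gain n e.+1 <= gain n e)%N.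
Proof.
have inc m : (forall k, (gain m k.+1 <= gain m k)%N) ->
    forall k, (gain m k <= gain m.+1 k)%N.
  by move=> h [|k] /=; rewrite ?leq_min leq_addr ?h.
suff dec : forall k, (gain n k.+1 <= gain n k)%N by split; first exact: inc.
elim: n => [//|n IHn] k.
by apply: leq_trans (gain_diag_le n k) (inc n IHn k).
Qed.

Lemma gain_noninc n e e' : (e <= e')%N -> (gain n e' <= gain n e)%N.
Proof.
elim: e' => [|e' IH]; first by rewrite leqn0 => /eqP ->.
rewrite leq_eqVlt ltnS => /orP[/eqP -> //|/IH]; apply: leq_trans.
exact: (gain_mono n e').2.
Qed.

Lemma gain_gt0 n e : (0 < gain n e)%N -> (e < n)%N.
Proof.
elim: n e => [|n IHn] [|e] // h; rewrite ltnS; apply: IHn.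
exact: leq_trans h (gain_diag_le n e).
Qed.

(** At a fixed time the tested value depends only on k - e, the diagonal of the new box. *)
Lemma gain_new n e k : (gain n e < k <= gain n.+1 e)%N ->
  gain n e = k.-1 /\ G n (d - e%:Z - n%:Z + k%:Z - 1).
Proof.
move=> /andP[h1 h2]; have h3 := gain_succ_le n e; have hk : gain n e = k.-1 by lia.
split=> //; move: h2 => /=; rewrite hk.
have -> : d - e%:Z - n%:Z + (k.-1)%:Z = d - e%:Z - n%:Z + k%:Z - 1 by lia.
case: (G n _) => //; case: e {h3 hk} h1 => [|e]; lia.
Qed.

Arguments gain : simpl never.

Variables (g r : nat) (J : pred nat).
Hypothesis r_gt0 : (0 < r)%N.
Hypothesis G_even : forall n y y', (0 < n < g)%N -> ~~ J n -> G n y -> G n y' ->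
  exists z : int, y - y' = 2 * z.
Hypothesis G_single : forall n y y', (n < g)%N -> J n -> G n y -> G n y' -> y = y'.
Hypothesis J0 : ~~ J 0%N.
Hypothesis J_last : ~~ J g.-1.
Hypothesis J_gap : forall n, J n -> ~~ J n.+1.

(* The k-th box of row e is (e, k), with k >= 1.  Both chains are eventually
   horizontal, along rows r and r - 1, and advance by one antidiagonal per step. *)
Let X s : nat * nat := (minn s r, (s - r).+1).
Let Y s : nat * nat := (minn s r.-1, (s - r.-1).+2).
Let filled n (c : nat * nat) := (c.2 <= gain n c.1)%N.

(** Going down the chain uses [gain_diag_le]; along row r, a row grows by at most one box per
    step. *)
Let X_next n s : ~~ filled n (X s) -> ~~ filled n.+1 (X s.+1).
Proof.
rewrite /filled /X /= -!ltnNge; case: (ltnP s r) => sr h.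
  have -> : minn s.+1 r = s.+1 by lia.
  have := gain_diag_le n s.
  lia.
have -> : minn s.+1 r = r by lia.
have := gain_succ_le n r.
lia.
Qed.

Let Y_next n s : ~~ filled n (Y s) -> ~~ filled n.+1 (Y s.+1).
Proof.
rewrite /filled /Y /= -!ltnNge; case: (ltnP s r.-1) => sr h.
  have -> : minn s.+1 r.-1 = s.+1 by lia.
  have := gain_diag_le n s.
  lia.
have -> : minn s.+1 r.-1 = r.-1 by lia.
have := gain_succ_le n r.-1.
lia.
Qed.

(** By [gain_diag_le] the row of [c'] at time n + 1 is no longer than the row above it at time n,
    hence than that of [c], which ends before the column of [c]. *)
Let same_diagonal n c c' : ~~ filled n c -> filled n.+1 c' -> (c.1 < c'.1)%N ->
  (c.2 + c'.1 = c'.2 + c.1)%N -> False.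
Proof.
case: c c' => e k [[|e'] k'] //; rewrite /filled /= -ltnNge => h1 h2 ee' kk'.
have := gain_noninc n (ee' : (e <= e')%N); have := gain_diag_le n e'.
rewrite /= in h2 *; lia.
Qed.

Let both_new n A B : (0 < n < g)%N ->
  ~~ filled n (X A) -> ~~ filled n (Y B) -> filled n.+1 (X A) -> filled n.+1 (Y B) ->
  ~~ J n /\ odd (A + B).
Proof.
move=> ng hA hB hA' hB'.
have [|_ gA] := @gain_new n (X A).1 (X A).2.
  by apply/andP; split; [rewrite ltnNge; exact: hA | exact: hA'].
have [|_ gB] := @gain_new n (Y B).1 (Y B).2.
  by apply/andP; split; [rewrite ltnNge; exact: hB | exact: hB'].
case Jn: (J n); last first.
  (* Modulo 2 the diagonals of [X A] and [Y B] are A + 1 and B. *)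
  split=> //; have [|z] := G_even ng _ gA gB; first by rewrite Jn.
  by rewrite /X /Y /=; lia.
have := G_single (proj2 (andP ng)) Jn gA gB => hAB.
have hd : ((X A).2 + (Y B).1 = (Y B).2 + (X A).1)%N by lia.
case: (ltngtP (X A).1 (Y B).1) => [lt|lt|eq].
- by case: (same_diagonal hA hB' lt hd).
- by case: (same_diagonal hB hA' lt (esym hd)).
(* In equal rows the boxes would coincide, but the chains are disjoint. *)
- by move: eq hd; rewrite /X /Y /=; lia.
Qed.

Let T n : nat := \sum_(0 <= m < n) ~~ J m.

Let T_step n : T n.+1 = (T n + ~~ J n)%N.
Proof. by rewrite /T big_nat_recr. Qed.

(* A + B grows by at most 2 at an ordinary step, by at most 1 if it is even, and by
   at most 1 at an exceptional step. *)
Let frontier n : (n < g)%N -> exists A B,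
  [/\ ~~ filled n.+1 (X A), ~~ filled n.+1 (Y B) & (A + B + 1 <= 2 * T n.+1 + J n)%N].
Proof.
elim: n => [|n IHn] ng.
  (* After the first cycle only the box (0, 1) can be filled. *)
  exists 1%N, 0%N; rewrite T_step /T big_geq // (negbTE J0) /=.
  split=> //; first by apply: X_next; rewrite /filled /X /=.
  by rewrite /filled /Y /= min0n sub0n; have := gain_succ_le 0 0; rewrite [gain 0 0]/gain; lia.
have [A [B [hA hB hAB]]] := IHn (ltnW ng).
(* The term [J n] is the unit won at an exceptional cycle. These cycles are isolated, and the parity
   condition takes the unit back at the next one. *)
have gap : (J n + J n.+1 <= 1)%N.
  by case Jn: (J n); [rewrite (negbTE (J_gap Jn)) | case: (J n.+1)].
have negJ : (~~ J n.+1 + J n.+1 = 1)%N by case: (J n.+1).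
rewrite T_step.
case fA: (filled n.+2 (X A)); case fB: (filled n.+2 (Y B)).
- have [|nJ oAB] := both_new _ hA hB fA fB; first by rewrite ng.
  exists A.+1, B.+1; split; rewrite ?X_next ?Y_next //.
  by rewrite nJ in negJ *; lia.
- exists A.+1, B; split; rewrite ?X_next ?fB //.
  by lia.
- exists A, B.+1; split; rewrite ?Y_next ?fA //.
  by lia.
- exists A, B; split; rewrite ?fA ?fB //.
  by lia.
Qed.

(** With N = [gain g r], the chain [X] is filled up to (r, N) and [Y] up to (r - 1, N), so A >= r +
    N and B >= r + N - 2. As the last cycle is ordinary, [frontier] bounds A + B + 1 by twice the
    number of ordinary cycles. *)
Lemma gain_bound : (2 <= gain g r)%N -> (r + gain g r + \sum_(0 <= m < g) J m <= g)%N.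
Proof.
move=> N2; have g0 : (0 < g)%N by rewrite (leq_ltn_trans _ (gain_gt0 (ltnW N2))).
have [|A [B [hA hB hAB]]] := frontier (n := g.-1); first by rewrite ltn_predL.
rewrite prednK // (negbTE J_last) in hA hB hAB.
have TE : (T g + \sum_(0 <= m < g) J m = g)%N.
  rewrite /T -big_split /= -[RHS]muln1 -[g in RHS]subn0 -sum_nat_const_nat.
  by apply: eq_bigr => m _; case: (J m).
have geA : (r + gain g r <= A)%N.
  rewrite leqNgt; apply: contra hA; rewrite /filled /X /= => hA.
  case: (ltnP A r) => Ar.
    by have := gain_noninc g (ltnW Ar); lia.
  lia.
have geB : (r + gain g r <= B + 2)%N.
  rewrite leqNgt; apply: contra hB; rewrite /filled /Y /= => hB.
  have := gain_noninc g (leq_pred r).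
  case: (ltnP B r.-1) => Br.
    by have := gain_noninc g (ltnW Br); lia.
  lia.
lia.
Qed.

End Gains.

(** * Lower bound for the degree *)

Section LowerBound.
Variables (R : realType) (g : nat) (Gamma : chain_of_cycles R g).
Local Notation cdiv := (divisor (chain_graph Gamma)).
Local Notation arc_of := (arc_of Gamma).
Local Notation loop_of := (loop_of Gamma).

(** Removing the chip lowers the level by one and shifts the coordinates before its cycle by one
    arc, which preserves goodness. *)
Lemma level_sub_point (D : cdiv) p n : (n <= cycle_index p)%N ->
  level (D - << p >>) n = level D n - 1.
Proof.
elim: n => [|n IHn] np; first by rewrite /= degB degU.
rewrite !levelS IHn ?(ltnW np) //; suff -> : good (D - << p >>) n (level D n - 1) =
    good D n (level D n) by lia.
have cE : cproj n (D - << p >>) = cproj n D - arc_of n.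
  by rewrite /cproj pairingB pairingU /proj np ltnNge (ltnW np) mul1r.
rewrite /good cE rmorphB mulrBr mulr1; apply: asbool_equiv_eq; split=> h.
  by have := eqmodD h (eqmod_refl _ (arc_of n)); rewrite !subrK.
exact: eqmodB h (eqmod_refl _ _).
Qed.

Lemma arc_nmod0 n (x : R) : eqmod (loop_of n) x 0 -> ~ eqmod (loop_of n) (x + arc_of n) 0.
Proof.
have a0 := arc_gt0 Gamma n; have al := arc_lt_loop Gamma n.
move=> [z hz] [z' hz']; have hl : arc_of n = (z' - z)%:~R * loop_of n.
  by rewrite rmorphB mulrBl -hz -hz'; ring.
have l0 : 0 < loop_of n := lt_trans a0 al.
move: a0 al; rewrite hl pmulr_lgt0 // gtr_pMl // ltr0z ltrz1; lia.
Qed.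

(* A chip spent on the cycle n is put at v_n or w_n, one of which makes the cycle
   costly. *)
Lemma adversary (D : cdiv) n e : (n <= g)%N -> exists E : cdiv,
  [/\ effective E, deg E = e%:Z, forall m, (n <= m < g)%N -> cproj m E = 0 &
      level (D - E) n <= deg D - e%:Z - n%:Z + (gain (good D) (deg D) n e)%:Z].
Proof.
elim: n e => [|n IHn] e ng.
  (* At the first v the chips have coordinate 0 on every cycle. *)
  exists << e%:Z *g vpt Gamma 0 >>; split.
  - exact: effectiveU.
  - exact: degU.
  - by move=> m mg; rewrite /cproj pairingU proj_vpt ?ltn0 ?mulr0 //; exact: genus_gt0 Gamma.
  - by rewrite /= degB degU; lia.
have stay : exists E : cdiv,
  [/\ effective E, deg E = e%:Z, forall m, (n < m < g)%N -> cproj m E = 0 &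
    level (D - E) n.+1 <= deg D - e%:Z - n.+1%:Z + (gain (good D) (deg D) n e
      + good D n (deg D - e%:Z - n%:Z + (gain (good D) (deg D) n e)%:Z))%N%:Z].
  have [E [hE dE cE lE]] := IHn e (ltnW ng); exists E; split=> //.
    by move=> m /andP[nm mg]; apply: cE; rewrite (ltnW nm).
  have goodE y : good (D - E) n y = good D n y.
    by rewrite /good /cproj pairingB -/(cproj n E) cE ?subr0 // leqnn.
  rewrite levelS goodE; move: lE; set y := _ + (gain _ _ _ _)%:Z.
  (* At equality goodness is tested at the same value; below it, even a free crossing respects the
     bound. *)
  rewrite le_eqVlt => /orP[/eqP ->|]; first by rewrite /y; lia.
  by case: (good D n _); case: (good D n _); rewrite /y; lia.
case: e stay => [|e] stay; first exact: stay.
case: (leqP (gain (good D) (deg D) n e.+1 + good D n (deg D - e.+1%:Z - n%:Z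
  + (gain (good D) (deg D) n e.+1)%:Z)) (gain (good D) (deg D) n e)) => hle.
  by rewrite gainSS (minn_idPl hle).
rewrite gainSS (minn_idPr (ltnW hle)).
have [E [hE dE cE lE]] := IHn e (ltnW ng).
have lp p : cycle_index p = n -> level (D - (E + << p >>)) n = level (D - E) n - 1.
  by move=> pn; rewrite opprD addrA level_sub_point ?pn.
have [p [pn hp]] : exists p, cycle_index p = n /\
    ~~ good (D - (E + << p >>)) n (level (D - (E + << p >>)) n).
  have vn : cycle_index (vpt Gamma n) = n by rewrite /= val_cycle_of.
  have wn : cycle_index (wpt Gamma n) = n by rewrite /= val_cycle_of.
  case hv: (good (D - (E + << vpt Gamma n >>)) n (level (D - (E + << vpt Gamma n >>)) n));
    last by exists (vpt Gamma n); rewrite hv.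
  exists (wpt Gamma n); split=> //; apply/negP => hw; move: hv hw; rewrite !lp //.
  move=> /asboolP h1 /asboolP h2; move: h1 h2.
  rewrite /cproj !pairingB !pairingD !pairingU proj_vpt // proj_wpt // ltnn leqnn !mul1r.
  set x := (level _ _ - 1)%:~R => h1 h2.
  have h3 := eqmodB h2 (eqmod_refl (loop_of n) (arc_of n * x)).
  have h4 := eqmodB h1 (eqmod_refl (loop_of n) (arc_of n * x)).
  rewrite !subrr in h3 h4; apply: (arc_nmod0 h3).
  by move: h4; congr (eqmod _ _ _); ring.
exists (E + << p >>); split.
- by apply: effectiveD => //; apply: effectiveU.
- by rewrite degD degU dE; lia.
- move=> m /andP[nm mg]; rewrite /cproj pairingD pairingU -/(cproj m E) cE ?mg ?(ltnW nm) //.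
  by rewrite /proj pn nm mulr0 addr0.
- rewrite levelS (negbTE hp) addr0 lp //; lia.
Qed.

Lemma winning_bound (D : cdiv) r : winning D r ->
  g%:Z + r%:Z <= deg D + (gain (good D) (deg D) g r)%:Z.
Proof.
move=> hD; have [E [hE dE _ lE]] := adversary D r (leqnn g).
have := hD E hE dE; lia.
Qed.

(** * Torsion as a condition on numbers of chips *)

Lemma torsion_pos_dvd (i : 'I_g) : (0 < torsion Gamma i)%N ->
  exists z : int, (torsion Gamma i)%:R * arc_len Gamma i = z%:~R * cycle_len Gamma i.
Proof.
rewrite /torsion; case: asboolP => // _; case: xgetP => [m _ [[_ hm] _] _|//].
exact: hm.
Qed.

(** A nontrivial relation makes the loop a rational multiple of the arc and |m| an admissible
    multiple, so a least positive one exists and the torsion is positive. *)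
Lemma torsion0_irrational (i : 'I_g) (m z : int) : torsion Gamma i = 0%N ->
  m%:~R * arc_len Gamma i = z%:~R * cycle_len Gamma i -> m = 0.
Proof.
move=> t0 hm; apply/eqP; case: (eqVneq m 0) => // m0.
have a0 := arc_len_gt0 Gamma i; have l0 := lt_trans a0 (arc_len_lt Gamma i).
have z0 : z != 0.
  apply: contraNneq m0 => z0; move/eqP: hm.
  by rewrite z0 mul0r mulf_eq0 (gt_eqF a0) orbF intr_eq0.
pose P (s : nat) := (0 < s)%N /\
  exists z : int, s%:R * arc_len Gamma i = z%:~R * cycle_len Gamma i.
have Pm : P `|m|%N.
  split; first by rewrite absz_gt0.
  have [mE|mE] : m = `|m|%N%:Z \/ m = - `|m|%N%:Z by lia.
    by exists z; rewrite -hm [in RHS]mE.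
  by exists (- z); rewrite rmorphN mulNr -hm [in RHS]mE rmorphN mulNr opprK.
have ex : exists s, `[< P s >] by exists `|m|%N; apply/asboolP.
case: (ex_minnP ex) => s /asboolP Ps smin.
move: t0; rewrite /torsion; case: asboolP => [_|[]]; last first.
  exists (m%:~R / z%:~R); rewrite fmorph_div /= !ratr_int mulrAC hm mulrAC mulfV ?mul1r //.
  by rewrite intr_eq0.
case: xgetP => [t _ [[t0 _] _] tE|/(_ s)[]]; first by rewrite tE in t0.
by split=> // t Pt; apply: smin; apply/asboolP.
Qed.

Lemma good_eqmod (D : cdiv) n y y' : good D n y -> good D n y' ->
  eqmod (loop_of n) ((y - y')%:~R * arc_of n) 0.
Proof.
move=> /asboolP h /asboolP h'; have := eqmodB (eqmod_trans (eqmod_sym h) h') (eqmod_refl _ (arc_of n * y'%:~R)).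
by rewrite subrr -mulrBr -rmorphB mulrC.
Qed.

Lemma good_torsion2 (D : cdiv) n y y' : torsion Gamma (cycle_of Gamma n) = 2%N ->
  good D n y -> good D n y' -> exists z : int, y - y' = 2 * z.
Proof.
move=> t2 hy hy'; have h := good_eqmod hy hy'.
have [|w] := torsion_pos_dvd (i := cycle_of Gamma n); first by rewrite t2.
rewrite t2 -/(arc_of n) -/(loop_of n) => hw.
have [q [hq|hq]] : exists q : int, y - y' = 2 * q \/ y - y' = 2 * q + 1.
  by exists ((y - y') %/ 2)%Z; lia.
- by exists q.
have [] := @arc_nmod0 n ((2 * q)%:~R * arc_of n).
  by exists (w * q); rewrite subr0 !rmorphM /= -mulrA [q%:~R * _]mulrC mulrA hw; ring.
by move: h; rewrite hq rmorphD /= mulrDl mul1r.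
Qed.

Lemma good_torsion0 (D : cdiv) n y y' : torsion Gamma (cycle_of Gamma n) = 0%N ->
  good D n y -> good D n y' -> y = y'.
Proof.
move=> t0 hy hy'; have [z] := good_eqmod hy hy'.
by rewrite subr0 => /(torsion0_irrational t0)/eqP; rewrite subr_eq0 => /eqP.
Qed.

End LowerBound.

Theorem theoremB (R : realType) (k g : nat) (Gamma : chain_of_cycles R g) :
  (1 <= k)%N -> martens_special Gamma k -> general_chain Gamma ->
  [/\ forall r : nat, (1 <= r <= g - k - 1)%N ->
        is_gonality (chain_graph Gamma) r (k%:Z + 2 * r%:Z),
      forall r : nat, (g - k <= r <= g - 1)%N ->
        is_gonality (chain_graph Gamma) r (r%:Z + g%:Z - 1) &
      forall r : nat, (g <= r)%N ->
        is_gonality (chain_graph Gamma) r (r%:Z + g%:Z)].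
Proof.
move=> _ [j [j_bound j_sorted j_torsion nj_torsion]] hgen.
have g0 : (0 < g)%N := genus_gt0 Gamma.
pose J : pred nat := fun n => n.+1 \in j.
have boundJ n : J n -> (2 <= n <= g - 3)%N by move=> /(allP j_bound); lia.
have J0 : ~~ J 0%N by apply/negP => /boundJ.
have J_last : ~~ J g.-1 by apply/negP => /boundJ; lia.
have J_gap n : J n -> ~~ J n.+1.
  move=> Jn; apply/negP => Jn1.
  have ord := sorted_ltn_index (leT := fun a b => (a + 2 <= b)%N) _ j_sorted.
  have {}ord : {in j &, forall x y, (index x j < index y j)%N -> (x + 2 <= y)%N}.
    by apply: ord => x y z; lia.
  case: (ltngtP (index n.+1 j) (index n.+2 j)) => [/ord|/ord|/index_inj].
  - by move=> /(_ Jn Jn1); lia.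
  - by move=> /(_ Jn1 Jn); lia.
  - by move=> /(_ 0%N Jn Jn1); lia.
have J_card : (\sum_(0 <= m < g) J m)%N = k.
  have j_uniq : uniq j.
    apply: (sorted_uniq ltn_trans ltnn); apply: sub_sorted j_sorted => x y.
    by lia.
  have -> : (\sum_(0 <= m < g) J m)%N = (\sum_(0 <= m < g | J m) 1)%N.
    by rewrite [RHS]big_mkcond; apply: eq_bigr => m _; case: (J m).
  rewrite sum1_count -size_filter -(size_map succn) -[RHS](size_tuple j).
  apply/perm_size/uniq_perm => //.
    by rewrite map_inj_uniq ?filter_uniq ?iota_uniq // => x y [].
  move=> x; apply/mapP/idP => [[m]|xj]; first by rewrite mem_filter => /andP[Jm _] ->.
  have x_bound : (3 <= x <= g - 2)%N := allP j_bound x xj.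
  exists x.-1; last by lia.
  by rewrite mem_filter mem_index_iota /J /= prednK ?xj; lia.
have odd_step (D : divisor (chain_graph Gamma)) n y y' : (0 < n < g)%N -> ~~ J n ->
    good D n y -> good D n y' -> exists z : int, y - y' = 2 * z.
  move=> /andP[n0 ng] Jn; apply: good_torsion2; apply: nj_torsion; rewrite val_cycle_of //.
have single (D : divisor (chain_graph Gamma)) n y y' : (n < g)%N -> J n ->
    good D n y -> good D n y' -> y = y'.
  move=> ng Jn; apply: good_torsion0; apply: hgen; first by have := boundJ n Jn; rewrite val_cycle_of //; lia.
  by apply: j_torsion; rewrite val_cycle_of.
(* The gain vanishes for r >= g; otherwise it is at most 1 or, by [gain_bound], at most g - k - r.
   These cases give the three ranges of r. *)
have bound (D : divisor (chain_graph Gamma)) r : (0 < r)%N -> winning D r ->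
    g%:Z + r%:Z <= deg D + (if (g <= r)%N then 0 else maxn 1 (g - k - r))%N%:Z.
  move=> r0 /winning_bound; set N := gain _ _ _ _.
  have N2 : (2 <= N)%N -> (r + N + k <= g)%N.
    move=> h; rewrite -J_card.
    by apply: (gain_bound (G := good D) (d := deg D) r0 _ _ J0 J_last J_gap h) => n y y';
      [apply: odd_step | apply: single].
  have N1 : (0 < N)%N -> (r < g)%N by exact: gain_gt0.
  case: leqP; lia.
(* The first cycle is not exceptional; hence g - k > 0 and the ranks of the second range are
   positive. *)
have kg : (k < g)%N.
  rewrite -J_card big_ltn // (negbTE J0) add0n.
  apply: (@leq_ltn_trans (\sum_(1 <= m < g) 1)); first by apply: leq_sum => m _; case: (J m).
  by rewrite sum_nat_const_nat muln1 ltn_subrL g0.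
split=> r hr.
- apply: gonalityI => [||D /bound hD]; [by lia | | by move: hD; case: ifP; lia].
  rewrite -J_card; apply: winning_special => // n /andP[n0 ng] Jn.
  have t2 : torsion Gamma (cycle_of Gamma n) = 2%N by apply: nj_torsion; rewrite val_cycle_of.
  have [|w] := torsion_pos_dvd (Gamma := Gamma) (i := cycle_of Gamma n); first by rewrite t2.
  by rewrite t2 => hw; exists w; rewrite subr0 mulrC hw.
- apply: gonalityI => [||D /bound hD]; [by lia | | by move: hD; case: ifP; lia].
  by apply: winning_canonical; lia.
- apply: gonalityI => [||D /bound hD]; [by lia | | by move: hD; case: ifP; lia].
  exists << r%:Z + g%:Z *g vpt Gamma 0 >>; first exact: degU.
  by apply: winning_of_deg; apply: degU.
Qed.
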